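(* Let $n$ be a positive integer and $\varphi(z)=bz$ for some $b\in\mathbb D\setminus\{0\}$. Then the composition–differentiation operator $D_{\varphi,n}f=f^{(n)}\circ\varphi$ on the Hardy space $H^2$ satisfies $$\|D_{\varphi,n}\|_{-1}=n!\binom{N}{n}|b|^{N-n},\qquad N=\Big\lfloor\frac{n}{1-|b|}\Big\rfloor.$$
   Context: $H^2$ is the Hardy space of analytic $f$ on the open unit disk $\mathbb D$ with $\|f\|^2=\sup_{0<r<1}\frac1{2\pi}\int_0^{2\pi}|f(re^{i\theta})|^2d\theta<\infty$; $\|T\|_{-1}$ denotes the operator norm on $H^2$. $\lfloor\cdot\rfloor$ is the greatest integer function. *)

(* Defs.v *)
From Stdlib Require Import Reals ClassicalEpsilon.
From Coquelicot Require Import Coquelicot.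
Open Scope R_scope.

Definition Cdiff (f : C -> C) (z : C) : Prop :=
  exists l : C, @is_derive C_AbsRing _ f z l.

Definition holo_disk (f : C -> C) : Prop :=
  forall z : C, Cmod z < 1 -> Cdiff f z.

Definition Cder (f : C -> C) : C -> C :=
  fun z => epsilon (inhabits (0%R, 0%R) : inhabited C)
                   (fun l : C => @is_derive C_AbsRing _ f z l).

Definition Cder_n (n : nat) (f : C -> C) : C -> C := Nat.iter n Cder f.

Definition hardy_mean (f : C -> C) (r : R) : R :=
  / (2 * PI) * RInt (fun t => (Cmod (f (r * cos t, r * sin t)%R)) ^ 2) 0 (2 * PI).

Definition hardy_means (f : C -> C) : R -> Prop :=
  fun x => exists r, 0 < r < 1 /\ x = hardy_mean f r.

Definition in_H2 (f : C -> C) : Prop :=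
  holo_disk f /\ exists M, forall x, hardy_means f x -> x <= M.

Definition H2norm (f : C -> C) : R := sqrt (real (Lub_Rbar (hardy_means f))).

Definition comp_diff (phi : C -> C) (n : nat) (f : C -> C) : C -> C :=
  fun z => Cder_n n f (phi z).

(* floor of a real number, as a nat (argument assumed nonnegative) *)
Definition floor_nat (x : R) : nat := Z.to_nat (up x - 1).

(* Main.v *)
(* Polar coordinates turn the integral of q(w) dw / w over the boundary of an
   annulus into the integral of a closed, merely differentiable 1-form over a
   rectangle, so Goursat's bisection argument shows that the mean of q over
   |w| = r does not depend on r; if q is continuous, this survives singularities
   on one circle.  Applied to q(w) = (f(w) - f(z)) w / (w - z), it gives the
   Taylor expansion f(z) = sum c_k z^k, and Parseval's identity identifies
   |f|^2 in H^2 with sum |c_k|^2.  In these coordinates D_{phi,n} sends the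
   monomial of degree j + n to (j+n)!/j! b^j times the monomial of degree j, so
   its norm is the largest of the gains (j+n)!/j! |b|^j.  The ratio of
   consecutive gains crosses 1 exactly at j + n = floor (n / (1 - |b|)). *)
Require Import Defs.
From Stdlib Require Import Reals Factorial ZArith Lra Lia ClassicalEpsilon.
From Coquelicot Require Import Coquelicot.
Open Scope R_scope.

(** * Goursat's lemma for closed differentiable 1-forms *)

(** [Cdiff] provides a derivative at each point but no continuity of it, so Green's theorem does not
    apply and a bisection argument has to take its place. The polar rectangle suits bisection: its
    sides at angles 0 and 2 pi carry the same values and cancel, which leaves exactly the two
    circles. Subtracting f(z) keeps the kernel bounded at w = z, and the factor w makes its mean 0;
    together they play the role of Cauchy's integral formula. Parseval's identity is stated for
    every coefficient sequence whose power series represents the function. The image under D_{phi,n}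
    gets its coefficients from termwise differentiation, a monomial has evident ones, and the Taylor
    expansion enters only for an arbitrary f in H^2. [H2norm] is the root of the real part of a
    supremum that is infinite for some functions. Comparisons therefore go through bounds on all
    partial sums of |c_k|^2, which yield membership in H^2 and the norm bound together. *)

Definition boundary_int (P Q : R -> R -> R) (x1 x2 y1 y2 : R) : R :=
  RInt (fun x => P x y1 - P x y2) x1 x2 + RInt (fun y => Q x2 y - Q x1 y) y1 y2.

Lemma continuous_slices (P : R -> R -> R) (x y : R) :
  continuity_2d_pt P x y ->
  continuous (fun u => P u y) x /\ continuous (fun v => P x v) y.
Proof.
  intros HP.
  split; apply filterlim_locally; intros eps;
    destruct (HP eps) as [d Hd]; exists d; intros w Hw; apply Hd; try exact Hw;
    rewrite Rminus_diag, Rabs_R0; apply cond_pos.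
Qed.

Lemma RInt_Rplus (f g : R -> R) (a b : R) :
  ex_RInt f a b -> ex_RInt g a b ->
  RInt (fun x => f x + g x) a b = RInt f a b + RInt g a b.
Proof. exact (RInt_plus f g a b). Qed.

Lemma RInt_near_const (f : R -> R) (a b c e : R) :
  a <= b -> ex_RInt f a b ->
  (forall x, a <= x <= b -> Rabs (f x - c) <= e) ->
  Rabs (RInt f a b - c * (b - a)) <= e * (b - a).
Proof.
  intros Hab Hf H.
  assert (E : RInt f a b - c * (b - a) = RInt (fun x => f x - c) a b).
  { symmetry; apply is_RInt_unique.
    replace (RInt f a b - c * (b - a)) with (minus (RInt f a b) (scal (b - a) c)).
    - apply (is_RInt_minus f (fun _ => c)).
      + exact (RInt_correct f a b Hf).
      + apply (is_RInt_const a b c).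
    - unfold minus, plus, opp, scal; simpl; unfold mult; simpl; ring. }
  rewrite E, (Rmult_comm e).
  apply abs_RInt_le_const; auto.
  apply (ex_RInt_minus f (fun _ => c)); auto. apply ex_RInt_const.
Qed.

Section Rectangles.

Variables (P Q : R -> R -> R) (xl xr : R).
Hypothesis P_cont : forall x y, xl < x < xr -> continuity_2d_pt P x y.
Hypothesis Q_cont : forall x y, xl < x < xr -> continuity_2d_pt Q x y.

Let ex_P (a b y1 y2 : R) : xl < a < xr -> xl < b < xr ->
  ex_RInt (fun x => P x y1 - P x y2) a b.
Proof.
  intros Ha Hb. apply (ex_RInt_continuous (fun x => P x y1 - P x y2)). intros z Hz.
  assert (xl < z < xr).
  { revert Hz; unfold Rmin, Rmax; destruct (Rle_dec a b); lra. }
  apply (continuous_minus (fun x => P x y1)); now apply continuous_slices, P_cont.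
Qed.

Let ex_Q (a b x1 x2 : R) : xl < x1 < xr -> xl < x2 < xr ->
  ex_RInt (fun y => Q x2 y - Q x1 y) a b.
Proof.
  intros Ha Hb. apply (ex_RInt_continuous (fun y => Q x2 y - Q x1 y)). intros z Hz.
  apply (continuous_minus (Q x2)); now apply continuous_slices, Q_cont.
Qed.

(** [boundary_int] is the counterclockwise integral of P dx + Q dy with opposite sides paired. Two
    adjacent rectangles run through their common side in opposite directions, so that side
    cancels. *)
Lemma boundary_int_split_x (x1 x2 x3 y1 y2 : R) :
  xl < x1 < xr -> xl < x2 < xr -> xl < x3 < xr ->
  boundary_int P Q x1 x3 y1 y2
  = boundary_int P Q x1 x2 y1 y2 + boundary_int P Q x2 x3 y1 y2.
Proof.
  intros H1 H2 H3. unfold boundary_int.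
  rewrite <- (RInt_Chasles (fun x => P x y1 - P x y2) x1 x2 x3) by auto.
  rewrite (RInt_ext (fun y => Q x3 y - Q x1 y)
             (fun y => (Q x2 y - Q x1 y) + (Q x3 y - Q x2 y))).
  2: { intros; simpl; ring. }
  rewrite RInt_Rplus by auto. unfold plus; simpl; ring.
Qed.

Lemma boundary_int_split_y (x1 x2 y1 y2 y3 : R) :
  xl < x1 < xr -> xl < x2 < xr ->
  boundary_int P Q x1 x2 y1 y3
  = boundary_int P Q x1 x2 y1 y2 + boundary_int P Q x1 x2 y2 y3.
Proof.
  intros H1 H2. unfold boundary_int.
  rewrite <- (RInt_Chasles (fun y => Q x2 y - Q x1 y) y1 y2 y3) by auto.
  rewrite (RInt_ext (fun x => P x y1 - P x y3)
             (fun x => (P x y1 - P x y2) + (P x y2 - P x y3))).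
  2: { intros; simpl; ring. }
  rewrite RInt_Rplus by auto. unfold plus; simpl; ring.
Qed.

(* The linear parts of P and Q contribute b * (y1 - y2) * (x2 - x1) and
   b * (x2 - x1) * (y2 - y1), which cancel because the form is closed. *)
Lemma boundary_int_small (x y a b d : R) (eps : R) :
  differentiable_pt_lim P x y a b -> differentiable_pt_lim Q x y b d -> 0 < eps ->
  exists delta, 0 < delta /\
  forall x1 x2 y1 y2 D, xl < x1 -> x2 < xr -> x1 <= x <= x2 -> y1 <= y <= y2 ->
    x2 - x1 <= D -> y2 - y1 <= D -> D < delta ->
    Rabs (boundary_int P Q x1 x2 y1 y2) <= 4 * eps * D * D.
Proof.
  intros HP HQ He.
  destruct (HP (mkposreal _ He)) as [d1 H1]. destruct (HQ (mkposreal _ He)) as [d2 H2].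
  simpl in H1, H2.
  exists (Rmin d1 d2); split.
  { apply Rmin_pos; apply cond_pos. }
  intros x1 x2 y1 y2 D Hxl Hxr Hx Hy HDx HDy HD.
  assert (D < d1) by (eapply Rlt_le_trans; [exact HD | apply Rmin_l]).
  assert (D < d2) by (eapply Rlt_le_trans; [exact HD | apply Rmin_r]).
  assert (Near : forall u v, x1 <= u <= x2 -> y1 <= v <= y2 ->
            Rabs (u - x) <= D /\ Rabs (v - y) <= D)
    by (intros; split; apply Rabs_le; lra).
  assert (BP : forall u v, x1 <= u <= x2 -> y1 <= v <= y2 ->
            Rabs (P u v - P x y - (a * (u - x) + b * (v - y))) <= eps * D).
  { intros u v Hu Hv. destruct (Near u v Hu Hv) as [N1 N2].
    eapply Rle_trans; [apply H1; lra|].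
    apply Rmult_le_compat_l; [lra|]. now apply Rmax_lub. }
  assert (BQ : forall u v, x1 <= u <= x2 -> y1 <= v <= y2 ->
            Rabs (Q u v - Q x y - (b * (u - x) + d * (v - y))) <= eps * D).
  { intros u v Hu Hv. destruct (Near u v Hu Hv) as [N1 N2].
    eapply Rle_trans; [apply H2; lra|].
    apply Rmult_le_compat_l; [lra|]. now apply Rmax_lub. }
  assert (B1 : Rabs (RInt (fun u => P u y1 - P u y2) x1 x2 - b * (y1 - y2) * (x2 - x1))
               <= 2 * eps * D * (x2 - x1)).
  { apply RInt_near_const; [lra | apply ex_P; lra |].
    intros u Hu. generalize (BP u y1 Hu ltac:(lra)) (BP u y2 Hu ltac:(lra)).
    intros A1 A2. apply Rabs_le_between in A1. apply Rabs_le_between in A2.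
    apply Rabs_le. lra. }
  assert (B2 : Rabs (RInt (fun v => Q x2 v - Q x1 v) y1 y2 - b * (x2 - x1) * (y2 - y1))
               <= 2 * eps * D * (y2 - y1)).
  { apply RInt_near_const; [lra | apply ex_Q; lra |].
    intros v Hv. generalize (BQ x1 v ltac:(lra) Hv) (BQ x2 v ltac:(lra) Hv).
    intros A1 A2. apply Rabs_le_between in A1. apply Rabs_le_between in A2.
    apply Rabs_le. lra. }
  unfold boundary_int. apply Rabs_le_between in B1. apply Rabs_le_between in B2.
  assert (0 <= eps * D) by (apply Rmult_le_pos; lra).
  assert (eps * D * (x2 - x1) <= eps * D * D) by (apply Rmult_le_compat_l; lra).
  assert (eps * D * (y2 - y1) <= eps * D * D) by (apply Rmult_le_compat_l; lra).
  apply Rabs_le. lra.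
Qed.

(** Pigeonhole: the four quarters add up to the whole, so one of them carries at least a quarter of
    its absolute value. *)
Lemma boundary_int_quarter (a c l k : R) :
  0 <= l -> xl < a -> a + 2 * l < xr ->
  exists p : R * R, (fst p = a \/ fst p = a + l) /\ (snd p = c \/ snd p = c + k) /\
    Rabs (boundary_int P Q a (a + 2 * l) c (c + 2 * k))
    <= 4 * Rabs (boundary_int P Q (fst p) (fst p + l) (snd p) (snd p + k)).
Proof.
  intros Hl Ha Hb.
  rewrite (boundary_int_split_x a (a + l) (a + 2 * l)) by lra.
  rewrite (boundary_int_split_y a (a + l) c (c + k) (c + 2 * k)) by lra.
  rewrite (boundary_int_split_y (a + l) (a + 2 * l) c (c + k) (c + 2 * k)) by lra.
  replace (a + 2 * l) with (a + l + l) by ring.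
  replace (c + 2 * k) with (c + k + k) by ring.
  set (I1 := boundary_int P Q a (a + l) c (c + k)).
  set (I2 := boundary_int P Q a (a + l) (c + k) (c + k + k)).
  set (I3 := boundary_int P Q (a + l) (a + l + l) c (c + k)).
  set (I4 := boundary_int P Q (a + l) (a + l + l) (c + k) (c + k + k)).
  set (S := Rabs (I1 + I2 + (I3 + I4))).
  assert (HS : S <= Rabs I1 + Rabs I2 + (Rabs I3 + Rabs I4)).
  { unfold S. eapply Rle_trans; [apply Rabs_triang|].
    apply Rplus_le_compat; apply Rabs_triang. }
  destruct (Rle_dec S (4 * Rabs I1)); [exists (a, c); simpl; auto|].
  destruct (Rle_dec S (4 * Rabs I2)); [exists (a, c + k); simpl; auto|].
  destruct (Rle_dec S (4 * Rabs I3)); [exists (a + l, c); simpl; auto|].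
  destruct (Rle_dec S (4 * Rabs I4)); [exists (a + l, c + k); simpl; auto|].
  lra.
Qed.

End Rectangles.

Lemma is_lim_seq_eps (u : nat -> R) (l e : R) :
  is_lim_seq u l -> 0 < e -> exists N, forall n, (N <= n)%nat -> Rabs (u n - l) < e.
Proof.
  intros H He. exact (proj2 (is_lim_seq_spec _ _) H (mkposreal _ He)).
Qed.

(** The point is the supremum of the left ends: by nesting, every left end lies below every right
    end. *)
Lemma nested_point (u : nat -> R) (L : R) :
  0 <= L ->
  (forall n, u n <= u (S n) /\ u (S n) + L / 2 ^ S n <= u n + L / 2 ^ n) ->
  exists x, forall n, u n <= x <= u n + L / 2 ^ n.
Proof.
  intros HL Hu.
  assert (Hle : forall n, 0 <= L / 2 ^ n).
  { intros n. apply Rmult_le_pos; auto. apply Rlt_le, Rinv_0_lt_compat, pow_lt; lra. }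
  assert (M : forall n k, u n <= u (n + k)%nat /\
              u (n + k)%nat + L / 2 ^ (n + k) <= u n + L / 2 ^ n).
  { intros n; induction k as [|k IH].
    - rewrite Nat.add_0_r; lra.
    - rewrite Nat.add_succ_r. destruct (Hu (n + k)%nat). lra. }
  assert (C : forall n m, u m <= u n + L / 2 ^ n).
  { intros n m. destruct (Nat.le_ge_cases n m) as [H|H].
    - destruct (M n (m - n)%nat) as [_ H2]. replace (n + (m - n))%nat with m in H2 by lia.
      generalize (Hle m); lra.
    - destruct (M m (n - m)%nat) as [H2 _]. replace (m + (n - m))%nat with n in H2 by lia.
      generalize (Hle n); lra. }
  destruct (completeness (fun y => exists n, y = u n)) as [x [Hx1 Hx2]].
  - exists (u O + L / 2 ^ 0). intros y [n ->]. apply C.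
  - exists (u O). now exists O.
  - exists x. intros n. split.
    + apply Hx1. now exists n.
    + apply Hx2. intros y [m ->]. apply C.
Qed.

(** The shared [b] is both the y-derivative of P and the x-derivative of Q; this is closedness,
    asked point by point. *)
Definition closed_form (P Q : R -> R -> R) (xl xr : R) : Prop :=
  forall x y, xl < x < xr -> exists a b d,
    differentiable_pt_lim P x y a b /\ differentiable_pt_lim Q x y b d.

Lemma goursat_rectangle (P Q : R -> R -> R) (xl xr x1 x2 y1 y2 : R) :
  closed_form P Q xl xr -> xl < x1 -> x1 <= x2 -> x2 < xr -> y1 <= y2 ->
  boundary_int P Q x1 x2 y1 y2 = 0.
Proof.
  intros HPQ Hxl Hx Hxr Hy.
  assert (CP : forall x y, xl < x < xr -> continuity_2d_pt P x y).
  { intros x y H. apply differentiable_continuity_pt.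
    destruct (HPQ x y H) as (a & b & d & H1 & _). now exists a, b. }
  assert (CQ : forall x y, xl < x < xr -> continuity_2d_pt Q x y).
  { intros x y H. apply differentiable_continuity_pt.
    destruct (HPQ x y H) as (a & b & d & _ & H1). now exists b, d. }
  set (L := x2 - x1). set (K := y2 - y1).
  assert (HL : 0 <= L) by (unfold L; lra). assert (HK : 0 <= K) by (unfold K; lra).
  assert (Half : forall t n, t / 2 ^ n = 2 * (t / 2 ^ S n)).
  { intros t n. simpl. field. apply pow_nonzero; lra. }
  set (J n (p : R * R) := Rabs (boundary_int P Q (fst p) (fst p + L / 2 ^ n)
                                 (snd p) (snd p + K / 2 ^ n))).
  set (good n (p p' : R * R) :=
         (fst p' = fst p \/ fst p' = fst p + L / 2 ^ S n) /\
         (snd p' = snd p \/ snd p' = snd p + K / 2 ^ S n) /\ J n p <= 4 * J (S n) p').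
  (* The chosen quarter is known to be good only while the current rectangle stays between x1 and
     x2, hence the invariant [Inv], proved alongside through [Step]. *)
  set (next n p := epsilon (inhabits p) (good n p)).
  set (corner := nat_rect (fun _ => R * R)%type (x1, y1) next).
  assert (Hle : forall n t, 0 <= t -> 0 <= t / 2 ^ n).
  { intros n t Ht. apply Rmult_le_pos; auto. apply Rlt_le, Rinv_0_lt_compat, pow_lt; lra. }
  assert (Step : forall n, x1 <= fst (corner n) -> fst (corner n) + L / 2 ^ n <= x2 ->
             good n (corner n) (corner (S n))).
  { intros n H1 H2. apply (epsilon_spec (inhabits (corner n)) (good n (corner n))).
    unfold good, J. rewrite (Half L n), (Half K n).
    apply (boundary_int_quarter P Q xl xr CP CQ); [now apply Hle | lra |].
    rewrite <- Half; lra. }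
  assert (Inv : forall n, x1 <= fst (corner n) /\ fst (corner n) + L / 2 ^ n <= x2).
  { induction n as [|n [I1 I2]].
    - simpl. unfold L. lra.
    - destruct (Step n I1 I2) as [[E|E] _]; rewrite E; rewrite (Half L n) in I2;
        generalize (Hle (S n) L HL); lra. }
  assert (G : forall n, good n (corner n) (corner (S n))).
  { intros n; apply Step; apply Inv. }
  destruct (nested_point (fun n => fst (corner n)) L HL) as [x Xn].
  { intros n. rewrite (Half L n). generalize (Hle (S n) L HL).
    destruct (G n) as [[E|E] _]; rewrite E; lra. }
  destruct (nested_point (fun n => snd (corner n)) K HK) as [y Yn].
  { intros n. rewrite (Half K n). generalize (Hle (S n) K HK).
    destruct (G n) as [_ [[E|E] _]]; rewrite E; lra. }
  assert (Grow : forall n, Rabs (boundary_int P Q x1 x2 y1 y2) <= 4 ^ n * J n (corner n)).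
  { induction n as [|n IH].
    - unfold J; simpl. unfold L, K.
      replace (x1 + (x2 - x1) / 1) with x2 by field.
      replace (y1 + (y2 - y1) / 1) with y2 by field. lra.
    - destruct (G n) as [_ [_ H]]. eapply Rle_trans; [exact IH|].
      simpl. rewrite (Rmult_comm 4), Rmult_assoc.
      apply Rmult_le_compat_l; [apply pow_le; lra | exact H]. }
  assert (Hx0 : xl < x < xr).
  { generalize (Xn O); simpl. unfold L. replace ((x2 - x1) / 1) with (x2 - x1) by field. lra. }
  destruct (HPQ x y Hx0) as (a & b & d & DP & DQ).
  (* One bound for both side lengths; the added 1 keeps it positive when the rectangle is
     degenerate. *)
  set (D := L + K + 1).
  assert (HD : 0 < D) by (unfold D; lra).
  apply Rabs_eq_0. apply Rle_antisym; [|apply Rabs_pos].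
  apply le_epsilon. intros e He. rewrite Rplus_0_l.
  (* With this tolerance the local estimate on a rectangle of size D / 2^n, multiplied by the 4^n
     lost in the n bisections, is exactly e. *)
  assert (Heps : 0 < e / (4 * D * D)) by (apply Rdiv_lt_0_compat; nra).
  destruct (boundary_int_small P Q xl xr CP CQ x y a b d _ DP DQ Heps) as (delta & Hd & Small).
  destruct (is_lim_seq_eps (fun n => (/ 2) ^ n) 0 (delta / D)) as [n Hn].
  { apply is_lim_seq_geom. rewrite Rabs_pos_eq; lra. }
  { now apply Rdiv_lt_0_compat. }
  specialize (Hn n (le_n n)). rewrite Rminus_0_r in Hn.
  rewrite pow_inv, Rabs_pos_eq in Hn by (apply Rlt_le, Rinv_0_lt_compat, pow_lt; lra).
  assert (P2 : 0 < 2 ^ n) by (apply pow_lt; lra).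
  assert (Hi : 0 < / 2 ^ n) by (now apply Rinv_0_lt_compat).
  eapply Rle_trans; [apply (Grow n)|].
  replace e with (4 ^ n * (4 * (e / (4 * D * D)) * (D / 2 ^ n) * (D / 2 ^ n))).
  2: { replace (4 ^ n) with (2 ^ n * 2 ^ n) by (rewrite <- Rpow_mult_distr; f_equal; lra).
       field. split; lra. }
  apply Rmult_le_compat_l; [apply pow_le; lra|].
  apply Small; try apply Xn; try apply Yn.
  - generalize (Inv n); lra.
  - generalize (Inv n); lra.
  - ring_simplify. apply Rmult_le_compat_r; unfold D; lra.
  - ring_simplify. apply Rmult_le_compat_r; unfold D; lra.
  - replace delta with (D * (delta / D)) by (field; lra).
    apply Rmult_lt_compat_l; auto.
Qed.

(** * Complex differentiability and polar coordinates *)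

Lemma Cmod_le_Rabs (z : C) : Cmod z <= Rabs (fst z) + Rabs (snd z).
Proof.
  unfold Cmod. apply Rsqr_incr_0_var.
  - rewrite Rsqr_sqrt by nra. unfold Rsqr.
    rewrite <- (pow2_abs (fst z)), <- (pow2_abs (snd z)).
    generalize (Rabs_pos (fst z)) (Rabs_pos (snd z)); nra.
  - generalize (Rabs_pos (fst z)) (Rabs_pos (snd z)); lra.
Qed.

Lemma Rabs_fst_le_Cmod (z : C) : Rabs (fst z) <= Cmod z.
Proof. eapply Rle_trans; [apply Rmax_l | apply Rmax_Cmod]. Qed.

Lemma Rabs_snd_le_Cmod (z : C) : Rabs (snd z) <= Cmod z.
Proof. eapply Rle_trans; [apply Rmax_r | apply Rmax_Cmod]. Qed.

Lemma is_derive_Cmod (f : C -> C) (z l : C) :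
  @is_derive C_AbsRing C_NormedModule f z l <->
  forall eps, 0 < eps -> exists delta, 0 < delta /\
    forall w : C, Cmod (w - z) < delta ->
    Cmod (f w - f z - (w - z) * l) <= eps * Cmod (w - z).
Proof.
  split.
  - intros [_ H] e He.
    destruct (H z (fun P HP => HP) (mkposreal _ He)) as [d Hd].
    exists d; split; [apply cond_pos|]. exact Hd.
  - intros H; split.
    + exact (is_linear_scal_l (V := C_NormedModule) l).
    + intros x Hx e.
      assert (E : z = x) by
        exact (@is_filter_lim_locally_unique C_AbsRing (AbsRing_NormedModule C_AbsRing) z x Hx).
      rewrite <- E.
      destruct (H e (cond_pos e)) as [d [Hd Hw]].
      exists (mkposreal _ Hd). exact Hw.
Qed.

(* The two normed-module structures on C have the same norm but different balls. *)
Lemma is_derive_AbsRing (f : C -> C) (z l : C) :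
  @is_derive C_AbsRing C_NormedModule f z l <->
  @is_derive C_AbsRing (AbsRing_NormedModule C_AbsRing) f z l.
Proof.
  split; intros H.
  - split; [exact (is_linear_scal_l (V := AbsRing_NormedModule C_AbsRing) l) | exact (proj2 H)].
  - split; [exact (is_linear_scal_l (V := C_NormedModule) l) | exact (proj2 H)].
Qed.

Lemma is_derive_Cmult (f g : C -> C) (z df dg : C) :
  @is_derive C_AbsRing C_NormedModule f z df ->
  @is_derive C_AbsRing C_NormedModule g z dg ->
  @is_derive C_AbsRing C_NormedModule (fun w => f w * g w)%C z (df * g z + f z * dg)%C.
Proof.
  rewrite !is_derive_AbsRing. intros Hf Hg.
  exact (is_derive_mult (K := C_AbsRing) f g z df dg Hf Hg Cmult_comm).
Qed.

Lemma Cdiff_mult (f g : C -> C) (z : C) :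
  Cdiff f z -> Cdiff g z -> Cdiff (fun w => f w * g w)%C z.
Proof. intros [a Ha] [b Hb]. eexists. apply is_derive_Cmult; eassumption. Qed.

Lemma Cdiff_const (a z : C) : Cdiff (fun _ => a) z.
Proof. exists zero. exact (is_derive_const (K := C_AbsRing) (V := C_NormedModule) a z). Qed.

Lemma Cdiff_minus_const (f : C -> C) (a z : C) :
  Cdiff f z -> Cdiff (fun w => f w - a)%C z.
Proof.
  intros [l Hl]. exists l. apply is_derive_Cmod. intros e He.
  destruct (proj1 (is_derive_Cmod _ _ _) Hl e He) as [d [Hd H]].
  exists d; split; auto. intros w Hw.
  replace (f w - a - (f z - a) - (w - z) * l)%C with (f w - f z - (w - z) * l)%C by ring. auto.
Qed.

Lemma Cdiff_id (z : C) : Cdiff (fun w => w) z.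
Proof.
  exists 1%C. apply is_derive_Cmod. intros e He. exists 1; split; [lra|]. intros w _.
  replace (w - z - (w - z) * 1)%C with (RtoC 0) by ring. rewrite Cmod_0.
  apply Rmult_le_pos; [lra | apply Cmod_ge_0].
Qed.

Lemma Cdiff_ext_near (f g : C -> C) (z : C) (d : R) :
  0 < d -> (forall w : C, Cmod (w - z) < d -> f w = g w) -> Cdiff f z -> Cdiff g z.
Proof.
  intros Hd E [l Hl]. exists l.
  apply (is_derive_ext_loc (K := C_AbsRing) (V := C_NormedModule) f); auto.
  exists (mkposreal _ Hd). exact E.
Qed.

Lemma Cmod_Cmod_triangle (z w : C) : Cmod w - Cmod z <= Cmod (w - z).
Proof.
  generalize (Cmod_triangle (w - z) z). replace (w - z + z)%C with w by ring. lra.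
Qed.

Lemma Cmod_minus_sym (z w : C) : Cmod (z - w) = Cmod (w - z).
Proof. rewrite <- Cmod_opp. f_equal. ring. Qed.

Lemma Cdiff_inv (a z : C) : z <> a -> Cdiff (fun w => / (w - a))%C z.
Proof.
  intros Hz. exists (- / ((z - a) * (z - a)))%C. apply is_derive_Cmod. intros e He.
  assert (Hza : (z - a)%C <> 0%C).
  { intros E. apply Hz. replace z with (z - a + a)%C by ring. rewrite E. ring. }
  assert (Hm : 0 < Cmod (z - a)) by (now apply Cmod_gt_0).
  set (m := Cmod (z - a)) in *.
  (* The exact error is (w - z)^2 / ((w - a)(z - a)^2). The first bound keeps |w - a| above m / 2;
     the second then makes the error at most e |w - z|. *)
  exists (Rmin (m / 2) (e * m ^ 3 / 2)); split.
  { apply Rmin_pos; [lra|]. apply Rdiv_lt_0_compat; [|lra].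
    apply Rmult_lt_0_compat; auto. now apply pow_lt. }
  intros w Hw.
  assert (H1 : Cmod (w - z) < m / 2) by (eapply Rlt_le_trans; [exact Hw | apply Rmin_l]).
  assert (H2 : Cmod (w - z) < e * m ^ 3 / 2) by (eapply Rlt_le_trans; [exact Hw | apply Rmin_r]).
  assert (H3 : m / 2 <= Cmod (w - a)).
  { generalize (Cmod_Cmod_triangle (z - w)%C (z - a)%C).
    replace (z - a - (z - w))%C with (w - a)%C by ring. rewrite (Cmod_minus_sym z w).
    fold m. lra. }
  assert (Hwa : (w - a)%C <> 0%C) by (apply Cmod_gt_0; lra).
  replace (/ (w - a) - / (z - a) - (w - z) * - / ((z - a) * (z - a)))%C
    with ((w - z) * (w - z) * (/ (w - a) * / ((z - a) * (z - a))))%C.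
  2: { field. auto. }
  rewrite !Cmod_mult, !Cmod_inv, Cmod_mult; auto.
  2: { now apply Cmult_neq_0. }
  fold m. rewrite Rmult_assoc, Rmult_comm.
  apply Rmult_le_compat_r; [apply Cmod_ge_0|].
  apply Rle_trans with (e * m ^ 3 / 2 * (/ (m / 2) * / (m * m))).
  2: { right. field. lra. }
  apply Rmult_le_compat.
  - apply Cmod_ge_0.
  - apply Rmult_le_pos; apply Rlt_le, Rinv_0_lt_compat; nra.
  - lra.
  - apply Rmult_le_compat_r; [apply Rlt_le, Rinv_0_lt_compat; nra|].
    apply Rinv_le_contravar; lra.
Qed.

Definition Ccont (f : C -> C) (z : C) : Prop :=
  forall eps, 0 < eps -> exists delta, 0 < delta /\
    forall w : C, Cmod (w - z) < delta -> Cmod (f w - f z) < eps.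

Lemma Cdiff_Ccont (f : C -> C) (z : C) : Cdiff f z -> Ccont f z.
Proof.
  intros [l Hl] e He.
  destruct (proj1 (is_derive_Cmod _ _ _) Hl 1 Rlt_0_1) as [d [Hd H]].
  assert (Hk : 0 < 1 + Cmod l) by (generalize (Cmod_ge_0 l); lra).
  exists (Rmin d (e / (1 + Cmod l))); split.
  { apply Rmin_pos; auto. now apply Rdiv_lt_0_compat. }
  intros w Hw.
  assert (H1 : Cmod (w - z) < d) by (eapply Rlt_le_trans; [exact Hw | apply Rmin_l]).
  assert (H2 : Cmod (w - z) < e / (1 + Cmod l)) by (eapply Rlt_le_trans; [exact Hw | apply Rmin_r]).
  specialize (H w H1).
  replace (f w - f z)%C with (f w - f z - (w - z) * l + (w - z) * l)%C by ring.
  eapply Rle_lt_trans; [apply Cmod_triangle|]. rewrite Cmod_mult.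
  apply Rle_lt_trans with (Cmod (w - z) * (1 + Cmod l)); [lra|].
  apply (Rmult_lt_compat_r _ _ _ Hk) in H2. replace e with (e / (1 + Cmod l) * (1 + Cmod l)); auto.
  field; lra.
Qed.

Definition polar (r t : R) : C := (r * cos t, r * sin t).

Lemma Cmod_polar (r t : R) : Cmod (polar r t) = Rabs r.
Proof.
  unfold Cmod, polar; simpl.
  rewrite <- sqrt_Rsqr_abs. f_equal. unfold Rsqr.
  generalize (sin2_cos2 t); unfold Rsqr; intros H.
  replace (r * r) with (r * r * (sin t * sin t + cos t * cos t)) by (rewrite H; ring). ring.
Qed.

Lemma polar_continuity (q : C -> C) (r t : R) :
  Ccont q (polar r t) ->
  continuity_2d_pt (fun r t => fst (q (polar r t))) r t /\
  continuity_2d_pt (fun r t => snd (q (polar r t))) r t.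
Proof.
  intros H.
  assert (Hp : filterlim (fun p : R * R => polar (fst p) (snd p)) (locally (r, t))
                 (locally (polar r t : R * R))).
  { apply filterlim_locally. intros e.
    assert (C1 : continuous (fun p : R * R => fst p * cos (snd p)) (r, t)).
    { apply (continuous_mult (fun p : R * R => fst p)).
      - apply continuous_fst.
      - apply (continuous_comp snd cos); [apply continuous_snd | apply continuous_cos]. }
    assert (C2 : continuous (fun p : R * R => fst p * sin (snd p)) (r, t)).
    { apply (continuous_mult (fun p : R * R => fst p)).
      - apply continuous_fst.
      - apply (continuous_comp snd sin); [apply continuous_snd | apply continuous_sin]. }
    apply (filter_and _ _ (proj1 (filterlim_locally _ _) C1 e)
                          (proj1 (filterlim_locally _ _) C2 e)). }
  assert (Hq : forall e : posreal, locally (r, t) (fun p : R * R =>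
            Cmod (q (polar (fst p) (snd p)) - q (polar r t)) < e)).
  { intros e. destruct (H e (cond_pos e)) as [d [Hd Hw]].
    assert (H2 : 0 < d / 2) by lra.
    refine (filter_imp _ _ _ (proj1 (filterlim_locally _ _) Hp (mkposreal _ H2))).
    intros p [B1 B2]. apply Hw. eapply Rle_lt_trans; [apply Cmod_le_Rabs|].
    change (Rabs (fst (polar (fst p) (snd p)) - fst (polar r t)) < d / 2) in B1.
    change (Rabs (snd (polar (fst p) (snd p)) - snd (polar r t)) < d / 2) in B2.
    simpl in *. unfold Rminus in *. lra. }
  split; apply continuity_2d_pt_filterlim; apply filterlim_locally; intros e;
    refine (filter_imp _ _ _ (Hq e)); intros p Hlt;
    (eapply Rle_lt_trans; [|exact Hlt]).
  - apply (Rabs_fst_le_Cmod (q (polar (fst p) (snd p)) - q (polar r t))).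
  - apply (Rabs_snd_le_Cmod (q (polar (fst p) (snd p)) - q (polar r t))).
Qed.

Lemma differentiable_polar_fst (r t : R) :
  differentiable_pt_lim (fun r t => fst (polar r t)) r t (cos t) (- r * sin t).
Proof.
  apply filterdiff_differentiable_pt_lim; simpl.
  evar_last.
  - apply (is_derive_filterdiff (fun r t => r * cos t) r t (fun _ t => cos t)).
    + apply filter_forall. intros p. auto_derive; auto. ring.
    + auto_derive; auto.
    + apply (continuous_comp snd cos); [apply continuous_snd | apply continuous_cos].
  - apply FunctionalExtensionality.functional_extensionality. intros p.
    unfold plus, scal; simpl; unfold mult; simpl. ring.
Qed.

Lemma differentiable_polar_snd (r t : R) :
  differentiable_pt_lim (fun r t => snd (polar r t)) r t (sin t) (r * cos t).
Proof.
  apply filterdiff_differentiable_pt_lim; simpl.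
  evar_last.
  - apply (is_derive_filterdiff (fun r t => r * sin t) r t (fun _ t => sin t)).
    + apply filter_forall. intros p. auto_derive; auto. ring.
    + auto_derive; auto.
    + apply (continuous_comp snd sin); [apply continuous_snd | apply continuous_sin].
  - apply FunctionalExtensionality.functional_extensionality. intros p.
    unfold plus, scal; simpl; unfold mult; simpl. ring.
Qed.

(** Multiplication by l, read as a real linear map of the plane, has rows (fst l, - snd l) and (snd
    l, fst l). *)
Lemma cauchy_riemann (q : C -> C) (x y : R) (l : C) :
  @is_derive C_AbsRing C_NormedModule q (x, y) l ->
  differentiable_pt_lim (fun x y => fst (q (x, y))) x y (fst l) (- snd l) /\
  differentiable_pt_lim (fun x y => snd (q (x, y))) x y (snd l) (fst l).
Proof.
  intros H.
  assert (K : forall e : posreal, locally_2d (fun u v =>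
     Cmod (q (u, v) - q (x, y) - ((u, v) - (x, y)) * l) <= e * Rmax (Rabs (u - x)) (Rabs (v - y))) x y).
  { intros e.
    (* The halving pays for passing from [Cmod] to the maximum norm, since [Cmod] is at most twice
       the larger coordinate. *)
    assert (He : 0 < e / 2) by (generalize (cond_pos e); lra).
    destruct (proj1 (is_derive_Cmod _ _ _) H _ He) as [d [Hd Hw]].
    assert (H2 : 0 < d / 2) by lra.
    exists (mkposreal _ H2); simpl. intros u v Hu Hv.
    assert (B : Cmod ((u, v) - (x, y)) <= Rabs (u - x) + Rabs (v - y)) by (apply Cmod_le_Rabs).
    eapply Rle_trans; [apply Hw; lra|].
    generalize (Rmax_l (Rabs (u - x)) (Rabs (v - y))) (Rmax_r (Rabs (u - x)) (Rabs (v - y))).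
    intros M1 M2. replace (e * Rmax (Rabs (u - x)) (Rabs (v - y)))
      with (e / 2 * (2 * Rmax (Rabs (u - x)) (Rabs (v - y)))) by field.
    apply Rmult_le_compat_l; lra. }
  split; intros e; destruct (K e) as [d Hd]; exists d; intros u v Hu Hv;
    (eapply Rle_trans; [|exact (Hd u v Hu Hv)]).
  - eapply Rle_trans; [|apply Rabs_fst_le_Cmod]. right. f_equal. simpl. ring.
  - eapply Rle_trans; [|apply Rabs_snd_le_Cmod]. right. f_equal. simpl. ring.
Qed.

Lemma differentiable_Rmult (x y : R) : differentiable_pt_lim Rmult x y y x.
Proof.
  apply filterdiff_differentiable_pt_lim.
  evar_last.
  - apply (is_derive_filterdiff Rmult x y (fun _ t => t)).
    + apply filter_forall. intros p. auto_derive; auto. ring.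
    + auto_derive; auto.
    + apply continuous_snd.
  - apply FunctionalExtensionality.functional_extensionality. intros p.
    unfold plus, scal; simpl; unfold mult; simpl. ring.
Qed.

(* The form is the real part of q(w) dw / (i w) in polar coordinates. *)
Lemma polar_closed_form (q : C -> C) (rl rr : R) :
  0 <= rl -> (forall z, rl < Cmod z < rr -> Cdiff q z) ->
  closed_form (fun r t => snd (q (polar r t)) * / r) (fun r t => fst (q (polar r t))) rl rr.
Proof.
  intros Hrl H r t Hr.
  destruct (H (polar r t)) as [l Hl].
  { rewrite Cmod_polar, Rabs_pos_eq; lra. }
  destruct (cauchy_riemann q (r * cos t) (r * sin t) l Hl) as [Hu Hv].
  pose proof (differentiable_pt_lim_comp _ _ _ r t _ _ _ _ _ _ Hu
                (differentiable_polar_fst r t) (differentiable_polar_snd r t)) as Du.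
  pose proof (differentiable_pt_lim_comp _ _ _ r t _ _ _ _ _ _ Hv
                (differentiable_polar_fst r t) (differentiable_polar_snd r t)) as Dv.
  assert (Di : derivable_pt_lim Rinv r (- / r ^ 2)).
  { apply is_derive_Reals. auto_derive; [lra|]. field; lra. }
  apply differentiable_pt_lim_proj1_0 with (y := t) in Di.
  pose proof (differentiable_pt_lim_comp _ _ _ r t _ _ _ _ _ _
                (differentiable_Rmult _ _) Dv Di) as Dp.
  cbv beta in Dp.
  do 3 eexists. split; [|exact Du].
  (* Polar Cauchy-Riemann: the angular derivative of the imaginary part is r times the radial
     derivative of the real part, and the weight 1 / r makes the two mixed derivatives equal. *)
  match type of Dp with differentiable_pt_lim _ _ _ _ ?b =>
    replace b with (fst l * cos t + - snd l * sin t) in Dp by (field; lra) end.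
  exact Dp.
Qed.

Definition circle_mean (q : C -> C) (r : R) : C :=
  (/ (2 * PI) * RInt (fun t => fst (q (polar r t))) 0 (2 * PI),
   / (2 * PI) * RInt (fun t => snd (q (polar r t))) 0 (2 * PI)).

Lemma circle_int_const (q : C -> C) (rl rr r1 r2 : R) :
  0 <= rl -> (forall z, rl < Cmod z < rr -> Cdiff q z) ->
  rl < r1 -> r1 <= r2 -> r2 < rr ->
  RInt (fun t => fst (q (polar r1 t))) 0 (2 * PI)
  = RInt (fun t => fst (q (polar r2 t))) 0 (2 * PI).
Proof.
  intros Hrl H H1 H12 H2. pose proof PI_RGT_0 as Hpi.
  assert (Hc : forall r, rl < r < rr ->
            ex_RInt (fun t => fst (q (polar r t))) 0 (2 * PI)).
  { intros r Hr. apply (ex_RInt_continuous (fun t => fst (q (polar r t)))). intros t _.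
    apply (continuous_slices (fun r t => fst (q (polar r t)))).
    apply polar_continuity, Cdiff_Ccont, H. rewrite Cmod_polar, Rabs_pos_eq; lra. }
  pose proof (goursat_rectangle _ _ rl rr r1 r2 0 (2 * PI) (polar_closed_form q rl rr Hrl H)
                H1 H12 H2 ltac:(lra)) as G.
  unfold boundary_int in G.
  (* The sides at angles 0 and 2 pi cancel by periodicity of [polar]. *)
  rewrite (RInt_ext _ (fun _ => 0)) in G.
  2: { intros x _. replace (polar x (2 * PI)) with (polar x 0).
       - apply Rminus_diag.
       - unfold polar. now rewrite cos_2PI, sin_2PI, cos_0, sin_0. }
  rewrite RInt_const in G.
  rewrite (RInt_minus (V := R_CompleteNormedModule)
             (fun t => fst (q (polar r2 t))) (fun t => fst (q (polar r1 t)))) in G by (apply Hc; lra).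
  unfold minus, plus, opp, scal in G; simpl in G; unfold mult in G; simpl in G. lra.
Qed.

Lemma circle_mean_const (q : C -> C) (rl rr r1 r2 : R) :
  0 <= rl -> (forall z, rl < Cmod z < rr -> Cdiff q z) ->
  rl < r1 < rr -> rl < r2 < rr -> circle_mean q r1 = circle_mean q r2.
Proof.
  intros Hrl H. 
  assert (K : forall r1 r2, rl < r1 < rr -> rl < r2 < rr -> r1 <= r2 ->
            circle_mean q r1 = circle_mean q r2).
  { clear r1 r2. intros r1 r2 H1 H2 H12. unfold circle_mean. f_equal; f_equal.
    - apply (circle_int_const q rl rr); tauto.
    (* Multiplication by -i moves the imaginary part of q into the real part. *)
    - pose proof (circle_int_const (fun z => q z * (0, -1))%C rl rr r1 r2 Hrl) as G.
      rewrite (RInt_ext _ (fun t => fst (q (polar r1 t) * (0, -1))%C)) by (intros; simpl; ring).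
      rewrite G; try tauto.
      + apply RInt_ext. intros; simpl; ring.
      + intros z Hz. apply Cdiff_mult; auto. apply Cdiff_const. }
  intros H1 H2. destruct (Rle_dec r1 r2); [apply K | symmetry; apply K]; auto; lra.
Qed.

(** * Means over circles *)

Lemma Cdiff_plus (f g : C -> C) (z : C) :
  Cdiff f z -> Cdiff g z -> Cdiff (fun w => f w + g w)%C z.
Proof.
  intros [a Ha] [b Hb]. exists (a + b)%C.
  exact (is_derive_plus (K := C_AbsRing) (V := C_NormedModule) f g z a b Ha Hb).
Qed.

Lemma Cdiff_ext (f g : C -> C) (z : C) : (forall w, f w = g w) -> Cdiff f z -> Cdiff g z.
Proof. intros E. apply (Cdiff_ext_near f g z 1); auto; lra. Qed.

Lemma Cdiff_pow (f : C -> C) (k : nat) (z : C) : Cdiff f z -> Cdiff (fun w => f w ^ k)%C z.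
Proof.
  intros H. induction k as [|k IH]; simpl.
  - apply Cdiff_const.
  - now apply (Cdiff_mult f (fun w => f w ^ k)%C).
Qed.

Lemma Cdiff_Cinv (z : C) : z <> 0%C -> Cdiff Cinv z.
Proof.
  intros Hz. apply (Cdiff_ext (fun w => / (w - 0))%C); [|now apply Cdiff_inv].
  intros w. f_equal. ring.
Qed.

Lemma Ccont_mult (f g : C -> C) (z : C) :
  Ccont f z -> Ccont g z -> Ccont (fun w => f w * g w)%C z.
Proof.
  intros Hf Hg e He.
  set (A := 1 + Cmod (f z)). set (B := 1 + Cmod (g z)).
  assert (HA : 1 <= A) by (unfold A; generalize (Cmod_ge_0 (f z)); lra).
  assert (HB : 1 <= B) by (unfold B; generalize (Cmod_ge_0 (g z)); lra).
  destruct (Hf (Rmin 1 (e / (2 * B)))) as [d1 [Hd1 H1]].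
  { apply Rmin_pos; [lra | apply Rdiv_lt_0_compat; lra]. }
  destruct (Hg (e / (2 * A))) as [d2 [Hd2 H2]].
  { apply Rdiv_lt_0_compat; lra. }
  exists (Rmin d1 d2); split; [now apply Rmin_pos|]. intros w Hw.
  specialize (H1 w (Rlt_le_trans _ _ _ Hw (Rmin_l _ _))).
  specialize (H2 w (Rlt_le_trans _ _ _ Hw (Rmin_r _ _))).
  pose proof (Rlt_le_trans _ _ _ H1 (Rmin_l _ _)) as H3.
  pose proof (Rlt_le_trans _ _ _ H1 (Rmin_r _ _)) as H4.
  replace (f w * g w - f z * g z)%C with (f w * (g w - g z) + (f w - f z) * g z)%C by ring.
  eapply Rle_lt_trans; [apply Cmod_triangle|]. rewrite !Cmod_mult.
  assert (HfA : Cmod (f w) <= A).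
  { generalize (Cmod_Cmod_triangle (f z) (f w)). unfold A; lra. }
  replace e with (A * (e / (2 * A)) + e / (2 * B) * B) by (field; lra).
  apply Rplus_lt_le_compat.
  - apply Rle_lt_trans with (A * Cmod (g w - g z)).
    + apply Rmult_le_compat_r; [apply Cmod_ge_0 | exact HfA].
    + apply Rmult_lt_compat_l; lra.
  - apply Rmult_le_compat; try apply Cmod_ge_0; try lra. unfold B; lra.
Qed.

Definition circle_integrable (q : C -> C) (r : R) : Prop :=
  ex_RInt (fun t => fst (q (polar r t))) 0 (2 * PI) /\
  ex_RInt (fun t => snd (q (polar r t))) 0 (2 * PI).

Lemma Ccont_circle_integrable (q : C -> C) (r : R) :
  (forall z, Cmod z = Rabs r -> Ccont q z) -> circle_integrable q r.
Proof.
  intros H. split.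
  - apply (ex_RInt_continuous (fun t => fst (q (polar r t)))). intros t _.
    apply (continuous_slices (fun r t => fst (q (polar r t)))).
    apply polar_continuity, H, Cmod_polar.
  - apply (ex_RInt_continuous (fun t => snd (q (polar r t)))). intros t _.
    apply (continuous_slices (fun r t => snd (q (polar r t)))).
    apply polar_continuity, H, Cmod_polar.
Qed.

Lemma Cdiff_circle_integrable (q : C -> C) (r : R) :
  (forall z, Cmod z = Rabs r -> Cdiff q z) -> circle_integrable q r.
Proof. intros H. apply Ccont_circle_integrable. intros z Hz. now apply Cdiff_Ccont, H. Qed.

Lemma circle_mean_ext (q p : C -> C) (r : R) :
  (forall z, Cmod z = Rabs r -> q z = p z) -> circle_mean q r = circle_mean p r.
Proof.
  intros H. unfold circle_mean. f_equal; f_equal; apply RInt_ext; intros t _;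
    now rewrite H by apply Cmod_polar.
Qed.

Lemma circle_mean_plus (q p : C -> C) (r : R) :
  circle_integrable q r -> circle_integrable p r ->
  circle_mean (fun w => q w + p w)%C r = (circle_mean q r + circle_mean p r)%C.
Proof.
  intros [H1 H2] [H3 H4]. unfold circle_mean, Cplus; simpl.
  f_equal; rewrite RInt_Rplus by assumption; ring.
Qed.

Lemma circle_mean_scal (a : C) (q : C -> C) (r : R) :
  circle_integrable q r -> circle_mean (fun w => a * q w)%C r = (a * circle_mean q r)%C.
Proof.
  intros [H1 H2]. unfold circle_mean, Cmult; simpl.
  assert (S : forall k f, ex_RInt f 0 (2 * PI) -> ex_RInt (fun t => k * f t) 0 (2 * PI) /\
            RInt (fun t => k * f t) 0 (2 * PI) = k * RInt f 0 (2 * PI)).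
  { intros k f Hf. split; [exact (ex_RInt_scal f 0 (2 * PI) k Hf)|].
    exact (RInt_scal (V := R_CompleteNormedModule) f 0 (2 * PI) k Hf). }
  destruct (S (fst a) _ H1) as [E1 E1']. destruct (S (snd a) _ H1) as [E2 E2'].
  destruct (S (fst a) _ H2) as [E3 E3']. destruct (S (snd a) _ H2) as [E4 E4'].
  destruct (S (-1) _ E4) as [E5 E5'].
  f_equal.
  - rewrite (RInt_ext _ (fun t => fst a * fst (q (polar r t)) + -1 * (snd a * snd (q (polar r t)))))
      by (intros; simpl; ring).
    rewrite RInt_Rplus, E1', E5', E4' by assumption. ring.
  - rewrite RInt_Rplus, E3', E2' by assumption. ring.
Qed.

(** The factor 2 comes from bounding the real and imaginary parts separately; it is harmless because
    the lemma only serves to make a remainder tend to 0. *)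
Lemma circle_mean_bound (q : C -> C) (r M : R) :
  circle_integrable q r -> (forall t, 0 <= t <= 2 * PI -> Cmod (q (polar r t)) <= M) ->
  Cmod (circle_mean q r) <= 2 * M.
Proof.
  intros [H1 H2] H. pose proof PI_RGT_0 as Hpi.
  assert (B : forall f : R -> R, ex_RInt f 0 (2 * PI) ->
            (forall t, 0 <= t <= 2 * PI -> Rabs (f t) <= M) ->
            Rabs (/ (2 * PI) * RInt f 0 (2 * PI)) <= M).
  { intros f Hf Hb. rewrite Rabs_mult, Rabs_pos_eq by (apply Rlt_le, Rinv_0_lt_compat; lra).
    replace M with (/ (2 * PI) * ((2 * PI - 0) * M)) by (field; lra).
    apply Rmult_le_compat_l; [apply Rlt_le, Rinv_0_lt_compat; lra|].
    apply abs_RInt_le_const; auto; lra. }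
  eapply Rle_trans; [apply Cmod_le_Rabs|]. unfold circle_mean; simpl.
  replace (2 * M) with (M + M) by ring.
  apply Rplus_le_compat; apply B; auto; intros t Ht; (eapply Rle_trans; [|exact (H t Ht)]).
  - apply Rabs_fst_le_Cmod.
  - apply Rabs_snd_le_Cmod.
Qed.

(** The circle of radius 0 is constantly the origin, so the mean value property becomes constancy of
    the mean down to the radius 0. *)
Lemma circle_mean_0 (q : C -> C) : circle_mean q 0 = q 0%C.
Proof.
  unfold circle_mean.
  assert (E : forall t, polar 0 t = 0%C) by (intros t; unfold polar; now rewrite !Rmult_0_l).
  rewrite (RInt_ext _ (fun _ => fst (q 0%C))) by (intros; now rewrite E).
  rewrite (RInt_ext (fun t => snd _) (fun _ => snd (q 0%C))) by (intros; now rewrite E).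
  rewrite !RInt_const. destruct (q 0%C) as [a b].
  unfold scal; simpl; unfold mult; simpl. pose proof PI_RGT_0.
  f_equal; field; lra.
Qed.

Lemma RInt_param_continuous (f : R -> R -> R) (r0 : R) (e : R) :
  (exists d, 0 < d /\ forall r t, Rabs (r - r0) < d -> continuity_2d_pt f r t) -> 0 < e ->
  exists d, 0 < d /\ forall r, Rabs (r - r0) < d ->
  Rabs (/ (2 * PI) * RInt (f r) 0 (2 * PI) - / (2 * PI) * RInt (f r0) 0 (2 * PI)) <= e.
Proof.
  intros [d1 [Hd1 H]] He. pose proof PI_RGT_0 as Hpi.
  destruct (uniform_continuity_2d_1d' f 0 (2 * PI) r0) with (eps := mkposreal _ He) as [d2 H2].
  { intros t _. apply H. now rewrite Rminus_diag, Rabs_R0. }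
  simpl in H2.
  exists (Rmin d1 d2); split; [apply Rmin_pos; auto; apply cond_pos|]. intros r Hr.
  assert (R1 : Rabs (r - r0) < d1) by (eapply Rlt_le_trans; [exact Hr | apply Rmin_l]).
  assert (R2 : Rabs (r - r0) < d2) by (eapply Rlt_le_trans; [exact Hr | apply Rmin_r]).
  assert (I : forall s, Rabs (s - r0) < d1 -> ex_RInt (f s) 0 (2 * PI)).
  { intros s Hs. apply (ex_RInt_continuous (f s)). intros t _. now apply continuous_slices, H. }
  assert (I0 : ex_RInt (f r0) 0 (2 * PI)) by (apply I; now rewrite Rminus_diag, Rabs_R0).
  rewrite <- Rmult_minus_distr_l.
  replace (RInt (f r) 0 (2 * PI) - RInt (f r0) 0 (2 * PI))
    with (RInt (fun t => f r t - f r0 t) 0 (2 * PI)).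
  2: { exact (RInt_minus (V := R_CompleteNormedModule) (f r) (f r0) 0 (2 * PI) (I r R1) I0). }
  rewrite Rabs_mult, Rabs_pos_eq by (apply Rlt_le, Rinv_0_lt_compat; lra).
  replace e with (/ (2 * PI) * ((2 * PI - 0) * e)) by (field; lra).
  apply Rmult_le_compat_l; [apply Rlt_le, Rinv_0_lt_compat; lra|].
  apply abs_RInt_le_const; [lra | |].
  - exact (ex_RInt_minus (f r) (f r0) 0 (2 * PI) (I r R1) I0).
  - intros t Ht. apply Rlt_le. apply Rabs_lt_between in R2.
    apply (H2 t r0 t r); try lra; generalize (cond_pos d2); try lra.
    intros. now rewrite Rminus_diag, Rabs_R0.
Qed.

Lemma circle_mean_continuous (q : C -> C) (r0 e : R) :
  (forall z, Cmod z < 1 -> Ccont q z) -> Rabs r0 < 1 -> 0 < e ->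
  exists d, 0 < d /\ forall r, Rabs (r - r0) < d ->
    Cmod (circle_mean q r - circle_mean q r0) <= e.
Proof.
  intros H Hr0 He.
  assert (He2 : 0 < e / 2) by lra.
  assert (N : forall r t, Rabs (r - r0) < 1 - Rabs r0 -> Ccont q (polar r t)).
  { intros r t Hr. apply H. rewrite Cmod_polar.
    generalize (Rabs_triang (r - r0) r0). replace (r - r0 + r0) with r by ring. lra. }
  destruct (RInt_param_continuous (fun r t => fst (q (polar r t))) r0 (e / 2)) with (2 := He2)
    as [d1 [Hd1 H1]].
  { exists (1 - Rabs r0); split; [lra|]. intros r t Hr. now apply polar_continuity, N. }
  destruct (RInt_param_continuous (fun r t => snd (q (polar r t))) r0 (e / 2)) with (2 := He2)
    as [d2 [Hd2 H2]].
  { exists (1 - Rabs r0); split; [lra|]. intros r t Hr. now apply polar_continuity, N. }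
  exists (Rmin d1 d2); split; [now apply Rmin_pos|]. intros r Hr.
  specialize (H1 r (Rlt_le_trans _ _ _ Hr (Rmin_l _ _))).
  specialize (H2 r (Rlt_le_trans _ _ _ Hr (Rmin_r _ _))).
  eapply Rle_trans; [apply Cmod_le_Rabs|]. simpl. unfold Rminus in *. lra.
Qed.

(* Singularities on a circle are harmless for a continuous function, since the
   mean is continuous in the radius. *)
Lemma circle_mean_value (q : C -> C) (rho r : R) :
  0 <= rho < 1 -> (forall z, Cmod z < 1 -> Ccont q z) ->
  (forall z, 0 < Cmod z < 1 -> Cmod z <> rho -> Cdiff q z) ->
  0 < r < 1 -> circle_mean q r = q 0%C.
Proof.
  intros Hrho Hc Hd Hr. rewrite <- circle_mean_0.
  (* A value taken by the mean at radii arbitrarily near a is also its value at a. This extends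
     constancy from the open ranges (rho, 1) and (0, rho) to their ends 0 and rho, where the two
     constants are glued; for rho = 0 the inner range is empty. *)
  assert (Lim : forall a c, 0 <= a < 1 ->
            (forall d, 0 < d -> exists s, Rabs (s - a) < d /\ circle_mean q s = c) ->
            circle_mean q a = c).
  { intros a c Ha Hs.
    assert (E : (c - circle_mean q a)%C = 0%C).
    { apply Cmod_eq_0. apply Rle_antisym; [|apply Cmod_ge_0].
      apply le_epsilon. intros e He. rewrite Rplus_0_l.
      destruct (circle_mean_continuous q a e Hc) as [d [Hd0 H]]; auto.
      { rewrite Rabs_pos_eq; lra. }
      destruct (Hs d Hd0) as [s [Hs1 <-]]. auto. }
    replace c with (c - circle_mean q a + circle_mean q a)%C by ring. rewrite E. ring. }
  assert (Out : forall s, rho < s < 1 -> circle_mean q s = circle_mean q rho).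
  { intros s Hs. symmetry. apply Lim; [lra|]. intros d Hd0.
    exists (rho + Rmin (d / 2) ((1 - rho) / 2)).
    pose proof (Rmin_pos (d / 2) ((1 - rho) / 2) ltac:(lra) ltac:(lra)).
    pose proof (Rmin_l (d / 2) ((1 - rho) / 2)). pose proof (Rmin_r (d / 2) ((1 - rho) / 2)).
    split; [rewrite Rabs_pos_eq; lra|].
    apply (circle_mean_const q rho 1); try lra. intros z Hz. apply Hd; lra. }
  assert (In : 0 < rho -> forall a, (a = 0 \/ a = rho) -> circle_mean q a = circle_mean q (rho / 2)).
  { intros H0 a Ha. apply Lim; [lra|]. intros d Hd0.
    pose proof (Rmin_pos (d / 2) (rho / 2) ltac:(lra) ltac:(lra)).
    pose proof (Rmin_l (d / 2) (rho / 2)). pose proof (Rmin_r (d / 2) (rho / 2)).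
    exists (if Req_dec_T a 0 then Rmin (d / 2) (rho / 2) else rho - Rmin (d / 2) (rho / 2)).
    destruct (Req_dec_T a 0) as [E|E].
    - split; [rewrite Rabs_pos_eq; lra|].
      apply (circle_mean_const q 0 rho); try lra. intros z Hz. apply Hd; lra.
    - split; [apply Rabs_def1; lra|].
      apply (circle_mean_const q 0 rho); try lra. intros z Hz. apply Hd; lra. }
  assert (Hrho0 : circle_mean q rho = circle_mean q 0).
  { destruct (Req_dec rho 0) as [->|Hne]; auto.
    now rewrite (In ltac:(lra) rho), (In ltac:(lra) 0) by auto. }
  destruct (Rlt_le_dec rho r) as [L|L]; [rewrite Out; auto; lra|].
  destruct (Req_dec r rho) as [->|Hne]; auto.
  rewrite (In ltac:(lra) 0) by auto.
  apply (circle_mean_const q 0 rho); try lra. intros z Hz. apply Hd; lra.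
Qed.

(** * Finite complex sums and means of powers of w *)

Definition Csum (a : nat -> C) (n : nat) : C := @sum_n C_AbelianMonoid a n.

Lemma Csum_0 (a : nat -> C) : Csum a 0 = a O.
Proof. exact (@sum_O C_AbelianMonoid a). Qed.

Lemma Csum_S (a : nat -> C) (n : nat) : Csum a (S n) = (Csum a n + a (S n))%C.
Proof. exact (@sum_Sn C_AbelianMonoid a n). Qed.

Lemma Csum_ext (a b : nat -> C) (n : nat) : (forall k, a k = b k) -> Csum a n = Csum b n.
Proof. exact (@sum_n_ext C_AbelianMonoid a b n). Qed.

Lemma Csum_scal (x : C) (a : nat -> C) (n : nat) :
  (x * Csum a n)%C = Csum (fun k => x * a k)%C n.
Proof.
  induction n as [|n IH]; [now rewrite !Csum_0|]. rewrite !Csum_S, <- IH. ring.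
Qed.

Lemma Csum_geom (x : C) (n : nat) :
  ((1 - x) * Csum (fun k => x ^ k) n = 1 - x ^ S n)%C.
Proof.
  induction n as [|n IH].
  - rewrite Csum_0. simpl. ring.
  - rewrite Csum_S, Cmult_plus_distr_l, IH. simpl. ring.
Qed.

Lemma Cdiff_Csum (a : nat -> C -> C) (n : nat) (z : C) :
  (forall k, Cdiff (a k) z) -> Cdiff (fun w => Csum (fun k => a k w) n) z.
Proof.
  intros H. induction n as [|n IH].
  - apply (Cdiff_ext (a O)); auto. intros w; now rewrite Csum_0.
  - apply (Cdiff_ext (fun w => Csum (fun k => a k w) n + a (S n) w)%C).
    + intros w; now rewrite Csum_S.
    + apply Cdiff_plus; auto.
Qed.

Lemma circle_mean_Csum (a : nat -> C -> C) (n : nat) (r : R) :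
  (forall k z, Cmod z = Rabs r -> Cdiff (a k) z) ->
  circle_mean (fun w => Csum (fun k => a k w) n) r = Csum (fun k => circle_mean (a k) r) n.
Proof.
  intros H. induction n as [|n IH].
  - rewrite Csum_0. apply circle_mean_ext. intros; now rewrite Csum_0.
  - rewrite Csum_S, <- IH.
    rewrite (circle_mean_ext _ (fun w => Csum (fun k => a k w) n + a (S n) w)%C).
    + apply circle_mean_plus; apply Cdiff_circle_integrable; intros z Hz; auto.
      apply Cdiff_Csum. auto.
    + intros; now rewrite Csum_S.
Qed.

Lemma polar_mult (r s t u : R) : (polar r t * polar s u)%C = polar (r * s) (t + u).
Proof. unfold polar, Cmult; simpl. rewrite cos_plus, sin_plus. f_equal; ring. Qed.

Lemma polar_inv (r t : R) : r <> 0 -> (/ polar r t)%C = polar (/ r) (- t).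
Proof.
  intros Hr.
  assert (E : (polar r t * polar (/ r) (- t))%C = 1%C).
  { rewrite polar_mult, Rplus_opp_r, Rinv_r by auto.
    unfold polar. rewrite cos_0, sin_0, Rmult_0_r, Rmult_1_l. reflexivity. }
  assert (Hp : polar r t <> 0%C).
  { apply Cmod_gt_0. rewrite Cmod_polar. now apply Rabs_pos_lt. }
  replace (polar (/ r) (- t)) with (/ polar r t * (polar r t * polar (/ r) (- t)))%C.
  - rewrite E. ring.
  - field; auto.
Qed.

Lemma polar_pow (r t : R) (k : nat) : (polar r t ^ k)%C = polar (r ^ k) (INR k * t).
Proof.
  induction k as [|k IH].
  - simpl. unfold polar. rewrite Rmult_0_l, cos_0, sin_0, Rmult_0_r, Rmult_1_l. reflexivity.
  - rewrite Cpow_S, IH, polar_mult, S_INR. f_equal. ring.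
Qed.

Lemma RInt_cos_sin_multiple (m : nat) : (0 < m)%nat ->
  is_RInt (fun t => cos (INR m * t)) 0 (2 * PI) 0 /\
  is_RInt (fun t => sin (INR m * t)) 0 (2 * PI) 0.
Proof.
  intros Hm. assert (Hm' : INR m <> 0) by (apply not_0_INR; lia).
  assert (Es : sin (INR m * (2 * PI)) = 0).
  { generalize (sin_period 0 m). rewrite sin_0. intros <-. f_equal. ring. }
  assert (Ec : cos (INR m * (2 * PI)) = 1).
  { generalize (cos_period 0 m). rewrite cos_0. intros <-. f_equal. ring. }
  split.
  - replace 0 with (minus (sin (INR m * (2 * PI)) / INR m) (sin (INR m * 0) / INR m)) at 2.
    + apply (is_RInt_derive (fun t => sin (INR m * t) / INR m)).
      * intros t _. auto_derive; auto. field; auto.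
      * intros t _. apply (continuous_comp (fun t => INR m * t) cos).
        -- apply (continuous_scal_r (INR m) (fun t : R => t)), continuous_id.
        -- apply continuous_cos.
    + rewrite Es, Rmult_0_r, sin_0. unfold minus, plus, opp; simpl. field; auto.
  - replace 0 with (minus (- cos (INR m * (2 * PI)) / INR m) (- cos (INR m * 0) / INR m)) at 2.
    + apply (is_RInt_derive (fun t => - cos (INR m * t) / INR m)).
      * intros t _. auto_derive; auto. field; auto.
      * intros t _. apply (continuous_comp (fun t => INR m * t) sin).
        -- apply (continuous_scal_r (INR m) (fun t : R => t)), continuous_id.
        -- apply continuous_sin.
    + rewrite Ec, Rmult_0_r, cos_0. unfold minus, plus, opp; simpl. field; auto.
Qed.

(** On the circle the function is r^(-m) exp(-i m t), which integrates to 0 over full periods. Both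
    the Cauchy expansion and the cross terms of Parseval's identity reduce to such negative
    powers. *)
Lemma circle_mean_pow_inv (m : nat) (r : R) : 0 < r -> (0 < m)%nat ->
  circle_mean (fun w => (/ w) ^ m)%C r = 0%C.
Proof.
  intros Hr Hm. destruct (RInt_cos_sin_multiple m Hm) as [Hc Hs].
  assert (E : forall t, ((/ polar r t) ^ m)%C = polar ((/ r) ^ m) (- (INR m * t))).
  { intros t. rewrite polar_inv, polar_pow by lra. f_equal. ring. }
  assert (S : forall k (f : R -> R), is_RInt f 0 (2 * PI) 0 -> RInt (fun t => k * f t) 0 (2 * PI) = 0).
  { intros k f Hf. apply is_RInt_unique. rewrite <- (Rmult_0_r k) at 2.
    exact (is_RInt_scal f 0 (2 * PI) k 0 Hf). }
  unfold circle_mean.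
  rewrite (RInt_ext (fun t => fst _) (fun t => (/ r) ^ m * cos (INR m * t))).
  2: { intros t _. rewrite E. simpl. now rewrite cos_neg. }
  rewrite (RInt_ext (fun t => snd _) (fun t => - (/ r) ^ m * sin (INR m * t))).
  2: { intros t _. rewrite E. simpl. rewrite sin_neg. ring. }
  rewrite (S _ (fun t => cos (INR m * t)) Hc), (S _ (fun t => sin (INR m * t)) Hs), Rmult_0_r.
  reflexivity.
Qed.

(** * Taylor expansion of holomorphic functions *)

Lemma circle_mean_cst (a : C) (r : R) : circle_mean (fun _ => a) r = a.
Proof.
  unfold circle_mean. rewrite !RInt_const. destruct a as [x y].
  unfold scal; simpl; unfold mult; simpl. pose proof PI_RGT_0. f_equal; field; lra.
Qed.

Lemma circle_integrable_bounded (q : C -> C) (r : R) :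
  circle_integrable q r ->
  exists M, forall t, 0 <= t <= 2 * PI -> Cmod (q (polar r t)) <= M.
Proof.
  intros [H1 H2]. pose proof PI_RGT_0 as Hpi.
  destruct (ex_RInt_ub _ _ _ H1) as [M1 B1]. destruct (ex_RInt_ub _ _ _ H2) as [M2 B2].
  rewrite Rmin_left, Rmax_right in B1, B2 by lra.
  exists (M1 + M2). intros t Ht. eapply Rle_trans; [apply Cmod_le_Rabs|].
  apply Rplus_le_compat; auto.
Qed.

Lemma is_series_Cmod (a : nat -> C) (l : C) :
  @is_series C_AbsRing C_NormedModule a l <->
  forall eps, 0 < eps -> exists N, forall n, (N <= n)%nat -> Cmod (Csum a n - l) < eps.
Proof.
  unfold is_series.
  rewrite (filterlim_locally_ball_norm (K := C_AbsRing) (U := C_NormedModule)).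
  split.
  - intros H e He. exact (H (mkposreal _ He)).
  - intros H e. exact (H e (cond_pos e)).
Qed.

Definition power_series (c : nat -> C) (f : C -> C) : Prop :=
  forall z, Cmod z < 1 ->
  @is_series C_AbsRing C_NormedModule (fun k => c k * z ^ k)%C (f z).

Lemma Cdiff_ext_ne (p q : C -> C) (a w : C) : w <> a ->
  (forall v, v <> a -> p v = q v) -> Cdiff p w -> Cdiff q w.
Proof.
  intros Hw E. apply (Cdiff_ext_near p q w (Cmod (w - a))).
  - apply Cmod_gt_0. intros H. apply Hw. replace w with (w - a + a)%C by ring.
    rewrite H. ring.
  - intros v Hv. apply E. intros ->. rewrite Cmod_minus_sym in Hv. lra.
Qed.

Lemma Csum_delta (x : C) (m n : nat) :
  Csum (fun k => if Nat.eqb k m then x else 0%C) n = if Nat.leb m n then x else 0%C.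
Proof.
  induction n as [|n IH].
  - rewrite Csum_0. destruct m; reflexivity.
  - rewrite Csum_S, IH. destruct (Nat.eqb_spec (S n) m), (Nat.leb_spec m n), (Nat.leb_spec m (S n));
      try lia; ring.
Qed.

Section Expansion.

Variable f : C -> C.
Hypothesis f_holo : holo_disk f.

(** This is Cauchy's integral of f(w) / w^(k+1), because dw / (2 pi i w) is the normalised angle.
    The radius 1/2 is an arbitrary choice in (0, 1). *)
Definition taylor_coef (k : nat) : C := circle_mean (fun w => f w * (/ w) ^ k)%C (/ 2).

Lemma taylor_coef_radius (k : nat) (r : R) : 0 < r < 1 ->
  circle_mean (fun w => f w * (/ w) ^ k)%C r = taylor_coef k.
Proof.
  intros Hr. apply (circle_mean_const _ 0 1); try lra.
  intros z Hz. apply Cdiff_mult; [now apply f_holo|].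
  apply Cdiff_pow, Cdiff_Cinv, Cmod_gt_0. lra.
Qed.

(* The parameter l stands for the derivative of f at z, which makes the kernel
   (f w - f z) w / (w - z) continuous at w = z. *)
Definition cauchy_kernel (z l w : C) : C :=
  ((if Ceq_dec w z then l else (f w - f z) * / (w - z)) * w)%C.

Lemma cauchy_kernel_Cdiff (z l w : C) : Cmod w < 1 -> w <> z -> Cdiff (cauchy_kernel z l) w.
Proof.
  intros Hw Hz. apply Cdiff_mult; [|apply Cdiff_id].
  apply (Cdiff_ext_ne (fun w => (f w - f z) * / (w - z))%C _ z); auto.
  - intros v Hv. destruct (Ceq_dec v z); tauto.
  - apply Cdiff_mult; [apply Cdiff_minus_const, f_holo; auto | now apply Cdiff_inv].
Qed.

Lemma cauchy_kernel_Ccont (z l : C) :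
  @is_derive C_AbsRing C_NormedModule f z l -> Ccont (cauchy_kernel z l) z.
Proof.
  intros Hl. apply Ccont_mult; [|apply Cdiff_Ccont, Cdiff_id].
  intros e He. assert (He2 : 0 < e / 2) by lra.
  destruct (proj1 (is_derive_Cmod _ _ _) Hl _ He2) as [d [Hd H]].
  exists d; split; auto. intros w Hw.
  destruct (Ceq_dec z z) as [_|]; [|tauto].
  destruct (Ceq_dec w z) as [|Hne].
  - replace (l - l)%C with (RtoC 0) by ring. now rewrite Cmod_0.
  - assert (Hne' : (w - z)%C <> 0%C).
    { intros E. apply Hne. replace w with (w - z + z)%C by ring. rewrite E. ring. }
    assert (Hp : 0 < Cmod (w - z)) by (now apply Cmod_gt_0).
    replace ((f w - f z) * / (w - z) - l)%C with ((f w - f z - (w - z) * l) * / (w - z))%C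
      by (field; auto).
    rewrite Cmod_mult, Cmod_inv by auto.
    apply Rle_lt_trans with (e / 2); [|lra].
    replace (e / 2) with (e / 2 * Cmod (w - z) * / Cmod (w - z)) by (field; lra).
    apply Rmult_le_compat_r; [now apply Rlt_le, Rinv_0_lt_compat | auto].
Qed.

(** The mean equals the value at the origin, which the factor w makes 0. The only point without
    known differentiability is w = z, so the exceptional circle is |w| = |z|. *)
Lemma cauchy_kernel_mean (z l : C) (r : R) : Cmod z < 1 ->
  @is_derive C_AbsRing C_NormedModule f z l -> 0 < r < 1 ->
  circle_mean (cauchy_kernel z l) r = 0%C.
Proof.
  intros Hz Hl Hr. rewrite (circle_mean_value _ (Cmod z)); auto.
  - unfold cauchy_kernel. ring.
  - split; [apply Cmod_ge_0 | auto].
  - intros w Hw. destruct (Ceq_dec w z) as [->|Hne].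
    + now apply cauchy_kernel_Ccont.
    + now apply Cdiff_Ccont, cauchy_kernel_Cdiff.
  - intros w Hw Hm. apply cauchy_kernel_Cdiff; [tauto|]. now intros ->.
Qed.

(** With x = z / w, the finite geometric sum turns the kernel times 1 - x^(n+1) into (f(w) - f(z))
    (1 + x + ... + x^n). Taking means gives the partial Taylor sum minus f(z) on one side and only
    the term with x^(n+1) on the other, so no limit is exchanged with an integral. *)
Lemma taylor_remainder (z l : C) (r : R) (n : nat) : Cmod z < r -> r < 1 ->
  @is_derive C_AbsRing C_NormedModule f z l ->
  (Csum (fun k => taylor_coef k * z ^ k) n - f z
   = - circle_mean (fun w => cauchy_kernel z l w * (z * / w) ^ S n) r)%C.
Proof.
  intros Hz Hr1 Hl. assert (Hr : 0 < r) by (generalize (Cmod_ge_0 z); lra).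
  assert (Nz : forall w, Cmod w = Rabs r -> w <> 0%C /\ w <> z /\ Cmod w < 1).
  { intros w Hw. rewrite Rabs_pos_eq in Hw by lra. repeat split; try lra.
    - apply Cmod_gt_0. lra.
    - intros ->. lra. }
  assert (Dinv : forall k w, Cmod w = Rabs r -> Cdiff (fun w => (/ w) ^ k)%C w).
  { intros k w Hw. now apply Cdiff_pow, Cdiff_Cinv, Nz. }
  assert (Df : forall k w, Cmod w = Rabs r -> Cdiff (fun w => f w * (/ w) ^ k)%C w).
  { intros k w Hw. apply Cdiff_mult; auto. now apply f_holo, Nz. }
  assert (Dk : forall w, Cmod w = Rabs r -> Cdiff (cauchy_kernel z l) w).
  { intros w Hw. apply cauchy_kernel_Cdiff; now apply Nz. }
  assert (Dx : forall w, Cmod w = Rabs r ->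
             Cdiff (fun w => cauchy_kernel z l w * (z * / w) ^ S n)%C w).
  { intros w Hw. apply Cdiff_mult; auto. apply Cdiff_pow, Cdiff_mult; [apply Cdiff_const|].
    now apply Cdiff_Cinv, Nz. }
  assert (E1 : circle_mean (fun w => Csum (fun k => z ^ k * (f w * (/ w) ^ k)) n)%C r
               = Csum (fun k => taylor_coef k * z ^ k)%C n).
  { rewrite circle_mean_Csum.
    - apply Csum_ext. intros k. rewrite circle_mean_scal.
      + rewrite taylor_coef_radius by lra. ring.
      + apply Cdiff_circle_integrable; auto.
    - intros k w Hw. apply Cdiff_mult; auto. apply Cdiff_const. }
  (* Only the term k = 0 has a nonzero mean. *)
  assert (E2 : circle_mean (fun w => Csum (fun k => z ^ k * (/ w) ^ k) n)%C r = 1%C).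
  { rewrite circle_mean_Csum.
    - rewrite (Csum_ext _ (fun k => if Nat.eqb k 0 then 1%C else 0%C)).
      + now rewrite Csum_delta.
      + intros k. rewrite circle_mean_scal by (apply Cdiff_circle_integrable; auto).
        destruct k as [|k].
        * simpl. rewrite circle_mean_cst. ring.
        * rewrite circle_mean_pow_inv by (auto; lia). simpl. ring.
    - intros k w Hw. apply Cdiff_mult; auto. apply Cdiff_const. }
  assert (E3 : (circle_mean (fun w => Csum (fun k => z ^ k * (f w * (/ w) ^ k)) n) r
     + - f z * circle_mean (fun w => Csum (fun k => z ^ k * (/ w) ^ k) n) r
     = circle_mean (cauchy_kernel z l) r
       + - (1) * circle_mean (fun w => cauchy_kernel z l w * (z * / w) ^ S n) r)%C).
  { assert (D1 : forall w, Cmod w = Rabs r ->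
               Cdiff (fun w => Csum (fun k => z ^ k * (f w * (/ w) ^ k)) n)%C w).
    { intros w Hw. apply Cdiff_Csum. intros k. apply Cdiff_mult; auto. apply Cdiff_const. }
    assert (D2 : forall w, Cmod w = Rabs r ->
               Cdiff (fun w => Csum (fun k => z ^ k * (/ w) ^ k) n)%C w).
    { intros w Hw. apply Cdiff_Csum. intros k. apply Cdiff_mult; auto. apply Cdiff_const. }
    rewrite <- !circle_mean_scal by (apply Cdiff_circle_integrable; auto).
    rewrite <- !circle_mean_plus.
    2, 3, 4, 5: apply Cdiff_circle_integrable; auto; intros w Hw;
      apply Cdiff_mult; auto; apply Cdiff_const.
    apply circle_mean_ext. intros w Hw. destruct (Nz w Hw) as (W0 & Wz & _).
    set (x := (z * / w)%C).
    rewrite (Csum_ext _ (fun k => f w * x ^ k)%C) by (intros k; unfold x; rewrite Cpow_mult_l; ring).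
    rewrite (Csum_ext (fun k => z ^ k * (/ w) ^ k)%C (fun k => x ^ k)%C)
      by (intros k; unfold x; now rewrite Cpow_mult_l).
    rewrite <- Csum_scal.
    replace (cauchy_kernel z l w + - (1) * (cauchy_kernel z l w * x ^ S n))%C
      with (cauchy_kernel z l w * (1 - x ^ S n))%C by ring.
    rewrite <- Csum_geom. unfold cauchy_kernel. destruct (Ceq_dec w z); [tauto|].
    replace (1 - x)%C with ((w - z) * / w)%C by (unfold x; field; auto).
    change (Csum (Cpow x) n) with (Csum (fun k => x ^ k)%C n).
    field. split; auto.
    intros E. apply Wz. replace w with (w - z + z)%C by ring. rewrite E. ring. }
  rewrite E1, E2, cauchy_kernel_mean in E3 by (auto; lra).
  replace (Csum (fun k => taylor_coef k * z ^ k) n - f z)%C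
    with (Csum (fun k => taylor_coef k * z ^ k) n + - f z * 1)%C by ring.
  rewrite E3. ring.
Qed.

Lemma taylor_power_series : power_series taylor_coef f.
Proof.
  intros z Hz. apply is_series_Cmod. intros e He.
  destruct (f_holo z Hz) as [l Hl].
  (* Any radius strictly between |z| and 1 would do: the kernel is bounded on that circle, and |z| /
     r < 1 makes the remainder decay geometrically. *)
  set (r := (Cmod z + 1) / 2).
  assert (Hr : Cmod z < r < 1) by (unfold r; lra).
  pose proof (Cmod_ge_0 z) as Hz0.
  assert (Nz : forall w, Cmod w = Rabs r -> w <> 0%C /\ w <> z /\ Cmod w < 1).
  { intros w Hw. rewrite Rabs_pos_eq in Hw by lra. repeat split; try lra.
    - apply Cmod_gt_0. lra.
    - intros ->. lra. }
  assert (Dk : forall w, Cmod w = Rabs r -> Cdiff (cauchy_kernel z l) w).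
  { intros w Hw. apply cauchy_kernel_Cdiff; now apply Nz. }
  destruct (circle_integrable_bounded (cauchy_kernel z l) r) as [M HM].
  { now apply Cdiff_circle_integrable. }
  assert (HM0 : 0 <= M).
  { eapply Rle_trans; [apply Cmod_ge_0|]. apply (HM 0). generalize PI_RGT_0; lra. }
  assert (Hq : 0 <= Cmod z / r < 1).
  { split.
    - apply Rmult_le_pos; [lra | apply Rlt_le, Rinv_0_lt_compat; lra].
    - apply (Rmult_lt_reg_r r); [lra|]. field_simplify; lra. }
  destruct (is_lim_seq_eps (fun n => (Cmod z / r) ^ n) 0 (e / (2 * M + 1))) as [N HN].
  { apply is_lim_seq_geom. rewrite Rabs_pos_eq; lra. }
  { apply Rdiv_lt_0_compat; lra. }
  exists N. intros n Hn. rewrite (taylor_remainder z l r), Cmod_opp by (auto; lra).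
  specialize (HN (S n) ltac:(lia)).
  rewrite Rminus_0_r, Rabs_pos_eq in HN by (apply pow_le; lra).
  apply Rle_lt_trans with (2 * (M * (Cmod z / r) ^ S n)).
  - apply circle_mean_bound.
    + apply Cdiff_circle_integrable. intros w Hw. apply Cdiff_mult; auto.
      apply Cdiff_pow, Cdiff_mult; [apply Cdiff_const|]. now apply Cdiff_Cinv, Nz.
    + intros t Ht. rewrite Cmod_mult, Cmod_pow, Cmod_mult, Cmod_inv, Cmod_polar, Rabs_pos_eq.
      * apply Rmult_le_compat_r; [apply pow_le; apply Hq | auto].
      * lra.
      * apply Nz, Cmod_polar.
  - apply Rle_lt_trans with ((2 * M) * (e / (2 * M + 1))).
    + rewrite <- Rmult_assoc. apply Rmult_le_compat_l; lra.
    + apply (Rmult_lt_reg_r (2 * M + 1)); [lra|].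
      replace (2 * M * (e / (2 * M + 1)) * (2 * M + 1)) with (2 * M * e) by (field; lra). lra.
Qed.

End Expansion.

(** * Termwise differentiation of power series *)

Lemma sum_n_S (a : nat -> R) (n : nat) : sum_n a (S n) = sum_n a n + a (S n).
Proof. exact (sum_Sn a n). Qed.

Lemma sum_n_le_compat (a b : nat -> R) (n : nat) :
  (forall k, a k <= b k) -> sum_n a n <= sum_n b n.
Proof.
  intros H. induction n as [|n IH]; [rewrite !sum_O; auto|].
  rewrite !sum_n_S. specialize (H (S n)). lra.
Qed.

Lemma sum_n_scal_r (x : R) (a : nat -> R) (n : nat) :
  sum_n (fun k => x * a k) n = x * sum_n a n.
Proof. exact (sum_n_mult_l (K := R_Ring) x a n). Qed.

Lemma sum_n_le_lim (a : nat -> R) (l : R) (n : nat) :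
  (forall k, 0 <= a k) -> is_series a l -> sum_n a n <= l.
Proof.
  intros Ha H. apply (is_lim_seq_incr_compare (sum_n a) l); [exact H|].
  intros k. rewrite sum_n_S. specialize (Ha (S k)). lra.
Qed.

Lemma Cmod_Csum_le (a : nat -> C) (b : nat -> R) (n : nat) :
  (forall k, Cmod (a k) <= b k) -> Cmod (Csum a n) <= sum_n b n.
Proof.
  intros H. induction n as [|n IH]; [rewrite Csum_0, sum_O; auto|].
  rewrite Csum_S, sum_n_S. eapply Rle_trans; [apply Cmod_triangle|].
  now apply Rplus_le_compat.
Qed.

Lemma power_series_coef_bound (c : nat -> C) (f : C -> C) (r : R) :
  power_series c f -> 0 < r < 1 -> exists M, 0 <= M /\ forall k, Cmod (c k) * r ^ k <= M.
Proof.
  intros H Hr.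
  assert (Hz : Cmod r < 1) by (rewrite Cmod_R, Rabs_pos_eq; lra).
  destruct (filterlim_bounded _ (ex_intro _ _ (H r Hz))) as [M HM].
  assert (HM' : forall n, Cmod (Csum (fun k => c k * r ^ k)%C n) <= M) by exact HM.
  assert (E : forall k, Cmod (c k) * r ^ k = Cmod (c k * r ^ k)).
  { intros k. rewrite Cmod_mult, Cmod_pow, Cmod_R, Rabs_pos_eq by lra. reflexivity. }
  assert (M0 : 0 <= M) by (eapply Rle_trans; [apply Cmod_ge_0 | apply (HM' O)]).
  (* Each term is a difference of two consecutive partial sums, and these are bounded by M. *)
  exists (2 * M); split; [lra|]. intros k. rewrite E. destruct k as [|k].
  - specialize (HM' O). rewrite Csum_0 in HM'. lra.
  - pose proof (Csum_S (fun k => c k * r ^ k)%C k) as ES. cbv beta in ES.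
    replace (c (S k) * r ^ S k)%C
      with (Csum (fun k => c k * r ^ k) (S k) + - Csum (fun k => c k * r ^ k) k)%C
      by (rewrite ES; ring).
    eapply Rle_trans; [apply Cmod_triangle|]. rewrite Cmod_opp.
    generalize (HM' (S k)) (HM' k). lra.
Qed.

Lemma ex_series_square_geom (q : R) : 0 < q < 1 ->
  ex_series (fun k => INR (S k) ^ 2 * q ^ k).
Proof.
  intros Hq.
  assert (Hp : forall k, 0 < INR (S k)) by (intros; apply lt_0_INR; lia).
  apply (ex_series_ext (fun k => Rabs (INR (S k) ^ 2 * q ^ k))).
  { intros k. apply Rabs_pos_eq. apply Rmult_le_pos; apply pow_le; [apply Rlt_le, Hp | lra]. }
  apply (ex_series_DAlembert _ q); [lra | |].
  { intros k. apply Rmult_integral_contrapositive_currified; apply pow_nonzero; [|lra].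
    apply Rgt_not_eq, Hp. }
  apply (is_lim_seq_ext (fun k => (1 + / INR (S k)) ^ 2 * q)).
  { intros k. rewrite (S_INR (S k)). specialize (Hp k).
    assert (Hqk : 0 < q ^ k) by (apply pow_lt; lra).
    rewrite Rabs_pos_eq.
    - simpl (q ^ S k). field. split; lra.
    - apply Rmult_le_pos.
      + apply Rmult_le_pos; apply pow_le; lra.
      + apply Rlt_le, Rinv_0_lt_compat, Rmult_lt_0_compat; auto. now apply pow_lt. }
  assert (L : is_lim_seq (fun k => 1 + / INR (S k)) 1).
  { replace (Finite 1) with (Finite (1 + 0)) by (f_equal; ring).
    apply is_lim_seq_plus'; [apply is_lim_seq_const|].
    apply (is_lim_seq_incr_1 (fun k => / INR k)).
    replace (Finite 0) with (Rbar_inv p_infty) by reflexivity.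
    apply is_lim_seq_inv; [apply is_lim_seq_INR | discriminate]. }
  replace (Finite q) with (Finite (1 * 1 * q)) by (f_equal; ring).
  apply is_lim_seq_mult'; [|apply is_lim_seq_const].
  apply (is_lim_seq_ext (fun k => (1 + / INR (S k)) * (1 + / INR (S k)))).
  { intros; ring. }
  now apply is_lim_seq_mult'.
Qed.

(** The coefficient bound at a radius s in (r, 1) leaves a geometric factor (r / s)^k that absorbs
    the polynomial weight. The weight (k+1)^2 dominates both the factor k of the derivative and the
    factor k^2 of the second-order error. *)
Lemma power_series_square_abs (c : nat -> C) (f : C -> C) (r : R) :
  power_series c f -> 0 < r < 1 -> ex_series (fun k => INR (S k) ^ 2 * (Cmod (c k) * r ^ k)).
Proof.
  intros H Hr. set (s := (1 + r) / 2).
  assert (Hs : 0 < s < 1) by (unfold s; lra). assert (Hrs : r < s) by (unfold s; lra).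
  destruct (power_series_coef_bound c f s H Hs) as [M [HM HB]].
  assert (Hq : 0 < r / s < 1).
  { split; [apply Rdiv_lt_0_compat; lra|]. apply (Rmult_lt_reg_r s); [lra|]. field_simplify; lra. }
  apply (ex_series_le (V := R_CompleteNormedModule) _ (fun k => M * (INR (S k) ^ 2 * (r / s) ^ k))).
  - intros k. change norm with Rabs. rewrite Rabs_pos_eq.
    + replace (M * (INR (S k) ^ 2 * (r / s) ^ k)) with (INR (S k) ^ 2 * (M * (r / s) ^ k)) by ring.
      apply Rmult_le_compat_l; [apply pow_le, pos_INR|].
      replace (r ^ k) with (s ^ k * (r / s) ^ k).
      * rewrite <- Rmult_assoc. apply Rmult_le_compat_r; [apply pow_le; lra | apply HB].
      * rewrite <- Rpow_mult_distr. f_equal. field. lra.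
    + apply Rmult_le_pos; [apply pow_le, pos_INR|].
      apply Rmult_le_pos; [apply Cmod_ge_0 | apply pow_le; lra].
  - exact (ex_series_scal M _ (ex_series_square_geom _ Hq)).
Qed.

(** At k = 0 the factor [INR k] vanishes, so the truncated exponent [pred 0] does no harm. *)
Definition pow_deriv (z : C) (k : nat) : C := (RtoC (INR k) * z ^ pred k)%C.

(** The factor r^2 on the left stands for an exponent k - 2 on the right, which would truncate in
    [nat]. The errors satisfy E_(k+1) = (z + h) E_k + k h^2 z^(k-1), and k^2 + k <= (k+1)^2 closes
    the induction. *)
Lemma pow_taylor_error (z h : C) (r : R) (k : nat) : 0 < r -> Cmod z <= r -> Cmod (z + h) <= r ->
  r ^ 2 * Cmod ((z + h) ^ k - z ^ k - h * pow_deriv z k) <= INR k ^ 2 * r ^ k * Cmod h ^ 2.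
Proof.
  intros Hr Hz Hzh. unfold pow_deriv. induction k as [|k IH].
  - simpl. replace (1 - 1 - h * (0 * 1))%C with (RtoC 0) by ring. rewrite Cmod_0. lra.
  - set (E := ((z + h) ^ k - z ^ k - h * (RtoC (INR k) * z ^ pred k))%C) in IH.
    assert (R1 : ((z + h) ^ S k - z ^ S k - h * (RtoC (INR (S k)) * z ^ pred (S k))
             = (z + h) * E + RtoC (INR k) * (h * h * z ^ pred k))%C).
    { unfold E. rewrite S_INR, RtoC_plus, !Cpow_S. destruct k as [|k]; simpl pred.
      - simpl. ring.
      - rewrite !Cpow_S. ring. }
    rewrite R1.
    assert (B2 : r ^ 2 * Cmod (RtoC (INR k) * (h * h * z ^ pred k)) <= INR k * r ^ S k * Cmod h ^ 2).
    { rewrite !Cmod_mult, Cmod_R, Cmod_pow, Rabs_pos_eq by apply pos_INR.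
      destruct k as [|k]; [simpl; lra|]. simpl pred.
      assert (Cmod z ^ k <= r ^ k) by (apply pow_incr; split; [apply Cmod_ge_0 | auto]).
      replace (r ^ 2 * (INR (S k) * (Cmod h * Cmod h * Cmod z ^ k)))
        with (INR (S k) * r ^ 2 * Cmod h ^ 2 * Cmod z ^ k) by ring.
      replace (INR (S k) * r ^ S (S k) * Cmod h ^ 2)
        with (INR (S k) * r ^ 2 * Cmod h ^ 2 * r ^ k) by (simpl; ring).
      apply Rmult_le_compat_l; auto.
      repeat apply Rmult_le_pos; try apply pow_le; try apply pos_INR; try apply Cmod_ge_0; lra. }
    assert (B1 : r ^ 2 * Cmod ((z + h) * E) <= INR k ^ 2 * r ^ S k * Cmod h ^ 2).
    { rewrite Cmod_mult.
      apply Rle_trans with (r * (r ^ 2 * Cmod E)).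
      - replace (r ^ 2 * (Cmod (z + h) * Cmod E)) with (Cmod (z + h) * (r ^ 2 * Cmod E)) by ring.
        apply Rmult_le_compat_r; auto. apply Rmult_le_pos; [apply pow_le; lra | apply Cmod_ge_0].
      - replace (INR k ^ 2 * r ^ S k * Cmod h ^ 2) with (r * (INR k ^ 2 * r ^ k * Cmod h ^ 2))
          by (simpl; ring).
        apply Rmult_le_compat_l; [lra | auto]. }
    apply Rle_trans with (r ^ 2 * Cmod ((z + h) * E)
                          + r ^ 2 * Cmod (RtoC (INR k) * (h * h * z ^ pred k))).
    { rewrite <- Rmult_plus_distr_l. apply Rmult_le_compat_l; [apply pow_le; lra | apply Cmod_triangle]. }
    assert (P : 0 <= r ^ S k * Cmod h ^ 2).
    { apply Rmult_le_pos; apply pow_le; [lra | apply Cmod_ge_0]. }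
    assert (Q : 0 <= INR k * (r ^ S k * Cmod h ^ 2)) by (apply Rmult_le_pos; [apply pos_INR | auto]).
    rewrite S_INR.
    replace ((INR k + 1) ^ 2 * r ^ S k * Cmod h ^ 2)
      with (INR k ^ 2 * r ^ S k * Cmod h ^ 2 + INR k * r ^ S k * Cmod h ^ 2
            + (INR k * (r ^ S k * Cmod h ^ 2) + r ^ S k * Cmod h ^ 2)) by ring.
    lra.
Qed.

Definition coef_deriv (c : nat -> C) (k : nat) : C := (RtoC (INR (S k)) * c (S k))%C.

Lemma Csum_pow_deriv (c : nat -> C) (z : C) (n : nat) :
  Csum (fun k => c k * pow_deriv z k)%C (S n) = Csum (fun k => coef_deriv c k * z ^ k)%C n.
Proof.
  unfold pow_deriv, coef_deriv. induction n as [|n IH].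
  - rewrite Csum_S, !Csum_0. simpl. ring.
  - rewrite Csum_S, IH, (Csum_S _ n). simpl pred. ring.
Qed.

Lemma Csum_plus (a b : nat -> C) (n : nat) :
  Csum (fun k => a k + b k)%C n = (Csum a n + Csum b n)%C.
Proof.
  induction n as [|n IH]; [now rewrite !Csum_0|]. rewrite !Csum_S, IH. ring.
Qed.

Lemma ex_series_coef_deriv (c : nat -> C) (f : C -> C) (z : C) :
  power_series c f -> Cmod z < 1 ->
  exists l, @is_series C_AbsRing C_NormedModule (fun k => coef_deriv c k * z ^ k)%C l.
Proof.
  intros H Hz. pose proof (Cmod_ge_0 z) as Hz0. set (r := (Cmod z + 1) / 2).
  assert (Hr : 0 < r < 1) by (unfold r; lra). assert (Hzr : Cmod z <= r) by (unfold r; lra).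
  apply (ex_series_le (K := C_AbsRing) (V := C_CompleteNormedModule) _
    (fun k => / r * (INR (S (S k)) ^ 2 * (Cmod (c (S k)) * r ^ S k)))).
  - intros k. change (Cmod (coef_deriv c k * z ^ k)
                      <= / r * (INR (S (S k)) ^ 2 * (Cmod (c (S k)) * r ^ S k))).
    unfold coef_deriv. rewrite !Cmod_mult, Cmod_R, Cmod_pow, Rabs_pos_eq by apply pos_INR.
    replace (/ r * (INR (S (S k)) ^ 2 * (Cmod (c (S k)) * r ^ S k)))
      with (INR (S (S k)) ^ 2 * Cmod (c (S k)) * r ^ k) by (simpl; field; lra).
    apply Rmult_le_compat.
    + apply Rmult_le_pos; [apply pos_INR | apply Cmod_ge_0].
    + apply pow_le, Cmod_ge_0.
    + apply Rmult_le_compat_r; [apply Cmod_ge_0|]. rewrite (S_INR (S k)).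
      generalize (pos_INR (S k)). nra.
    + apply pow_incr. auto.
  - apply (ex_series_scal (/ r) (fun k => INR (S (S k)) ^ 2 * (Cmod (c (S k)) * r ^ S k))).
    apply (proj1 (ex_series_incr_1 (fun k => INR (S k) ^ 2 * (Cmod (c k) * r ^ k)))).
    now apply (power_series_square_abs c f).
Qed.

Lemma Cmod_lim_le (x : C) (C0 : R) :
  (forall eps, 0 < eps -> exists y : C, Cmod (x - y) <= eps /\ Cmod y <= C0) -> Cmod x <= C0.
Proof.
  intros H. apply le_epsilon. intros e He. destruct (H e He) as (y & H1 & H2).
  replace x with (x - y + y)%C by ring. eapply Rle_trans; [apply Cmod_triangle|]. lra.
Qed.

Lemma power_series_quadratic_error (c : nat -> C) (f : C -> C) (z l : C) (r : R) :
  power_series c f -> 0 < r < 1 -> Cmod z <= r ->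
  @is_series C_AbsRing C_NormedModule (fun k => coef_deriv c k * z ^ k)%C l ->
  exists B, 0 <= B /\ forall w : C, Cmod w <= r ->
    Cmod (f w - f z - (w - z) * l) <= B * Cmod (w - z) ^ 2.
Proof.
  intros H Hr Hz Hl.
  destruct (power_series_square_abs c f r H Hr) as [B HB].
  assert (Pos : forall k, 0 <= INR (S k) ^ 2 * (Cmod (c k) * r ^ k)).
  { intros k. apply Rmult_le_pos; [apply pow_le, pos_INR|].
    apply Rmult_le_pos; [apply Cmod_ge_0 | apply pow_le; lra]. }
  assert (HB' : forall n, sum_n (fun k => INR (S k) ^ 2 * (Cmod (c k) * r ^ k)) n <= B).
  { intros n. now apply sum_n_le_lim. }
  assert (B0 : 0 <= B) by (eapply Rle_trans; [|apply (HB' O)]; rewrite sum_O; apply Pos).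
  assert (R2 : 0 < / r ^ 2) by (apply Rinv_0_lt_compat, pow_lt; lra).
  exists (/ r ^ 2 * B); split; [apply Rmult_le_pos; lra|].
  intros w Hw. set (h := (w - z)%C).
  assert (Ew : (z + h)%C = w) by (unfold h; ring).
  apply Cmod_lim_le. intros e He.
  assert (Hh : 0 <= Cmod h) by apply Cmod_ge_0.
  (* Two errors of size e' come from the values at w and z, and one of size |h| e' from the
     derivative; their sum is e. *)
  set (e' := e / (2 + Cmod h)). assert (He' : 0 < e') by (apply Rdiv_lt_0_compat; lra).
  destruct (proj1 (is_series_Cmod _ _) (H w ltac:(lra)) e' He') as [N1 H1].
  destruct (proj1 (is_series_Cmod _ _) (H z ltac:(lra)) e' He') as [N2 H2].
  destruct (proj1 (is_series_Cmod _ _) Hl e' He') as [N3 H3].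
  set (n := (N1 + N2 + N3)%nat).
  (* The sums for f run one index further than the sum for the derivative, because differentiation
     lowers degrees by one. *)
  specialize (H1 (S n) ltac:(lia)). specialize (H2 (S n) ltac:(lia)). specialize (H3 n ltac:(lia)).
  set (A1 := Csum (fun k => c k * w ^ k)%C (S n)) in *.
  set (A2 := Csum (fun k => c k * z ^ k)%C (S n)) in *.
  set (A3 := Csum (fun k => coef_deriv c k * z ^ k)%C n) in *.
  exists (A1 - A2 - h * A3)%C. split.
  - replace (f w - f z - h * l - (A1 - A2 - h * A3))%C
      with (- (A1 - f w) + ((A2 - f z) + h * (A3 - l)))%C by ring.
    eapply Rle_trans; [apply Cmod_triangle|]. rewrite Cmod_opp.
    eapply Rle_trans; [apply Rplus_le_compat_l, Cmod_triangle|]. rewrite Cmod_mult.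
    assert (Cmod h * Cmod (A3 - l) <= Cmod h * e') by (apply Rmult_le_compat_l; lra).
    replace e with (e' + (e' + Cmod h * e')) by (unfold e'; field; lra). lra.
  - assert (E : (A1 - A2 - h * A3)%C
        = Csum (fun k => c k * ((z + h) ^ k - z ^ k - h * pow_deriv z k))%C (S n)).
    { unfold A3. rewrite <- Csum_pow_deriv.
      rewrite (Csum_ext (fun k => c k * ((z + h) ^ k - z ^ k - h * pow_deriv z k))%C
                 (fun k => c k * w ^ k + (-(1) * (c k * z ^ k) + - h * (c k * pow_deriv z k)))%C)
        by (intros; rewrite Ew; ring).
      rewrite Csum_plus, Csum_plus, <- !Csum_scal. fold A1 A2. ring. }
    rewrite E. eapply Rle_trans.
    + apply (Cmod_Csum_le _ (fun k => / r ^ 2 * Cmod h ^ 2 * (INR (S k) ^ 2 * (Cmod (c k) * r ^ k)))).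
      intros k. rewrite Cmod_mult.
      pose proof (pow_taylor_error z h r k ltac:(lra) Hz ltac:(now rewrite Ew)) as T.
      set (e0 := Cmod ((z + h) ^ k - z ^ k - h * pow_deriv z k)) in *.
      apply (Rmult_le_compat_l _ _ _ (Rlt_le _ _ R2)) in T.
      rewrite <- Rmult_assoc, Rinv_l, Rmult_1_l in T by (apply pow_nonzero; lra).
      assert (Hk : INR k ^ 2 <= INR (S k) ^ 2).
      { apply pow_incr. split; [apply pos_INR | apply le_INR; lia]. }
      apply Rle_trans with (Cmod (c k) * (/ r ^ 2 * (INR k ^ 2 * r ^ k * Cmod h ^ 2))).
      { apply Rmult_le_compat_l; [apply Cmod_ge_0 | exact T]. }
      replace (Cmod (c k) * (/ r ^ 2 * (INR k ^ 2 * r ^ k * Cmod h ^ 2)))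
        with (/ r ^ 2 * Cmod h ^ 2 * (Cmod (c k) * r ^ k) * INR k ^ 2) by ring.
      replace (/ r ^ 2 * Cmod h ^ 2 * (INR (S k) ^ 2 * (Cmod (c k) * r ^ k)))
        with (/ r ^ 2 * Cmod h ^ 2 * (Cmod (c k) * r ^ k) * INR (S k) ^ 2) by ring.
      apply Rmult_le_compat_l; auto.
      repeat apply Rmult_le_pos; try apply pow_le; try apply Cmod_ge_0; lra.
    + rewrite sum_n_scal_r.
      replace (/ r ^ 2 * B * Cmod h ^ 2) with (/ r ^ 2 * Cmod h ^ 2 * B) by ring.
      apply Rmult_le_compat_l; auto.
      apply Rmult_le_pos; [lra | apply pow_le; lra].
Qed.

Lemma power_series_is_derive (c : nat -> C) (f : C -> C) (z l : C) :
  power_series c f -> Cmod z < 1 ->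
  @is_series C_AbsRing C_NormedModule (fun k => coef_deriv c k * z ^ k)%C l ->
  @is_derive C_AbsRing C_NormedModule f z l.
Proof.
  intros H Hz Hl. pose proof (Cmod_ge_0 z) as Hz0. set (r := (Cmod z + 1) / 2).
  assert (Hr : 0 < r < 1) by (unfold r; lra). assert (Hzr : Cmod z < r) by (unfold r; lra).
  destruct (power_series_quadratic_error c f z l r H Hr ltac:(lra) Hl) as [B [HB0 HB]].
  apply is_derive_Cmod. intros e He.
  exists (Rmin (r - Cmod z) (e / (B + 1))); split.
  { apply Rmin_pos; [lra | apply Rdiv_lt_0_compat; lra]. }
  intros w Hw.
  pose proof (Rlt_le_trans _ _ _ Hw (Rmin_l _ _)) as W1.
  pose proof (Rlt_le_trans _ _ _ Hw (Rmin_r _ _)) as W2.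
  eapply Rle_trans; [apply HB; generalize (Cmod_Cmod_triangle z w); lra|].
  simpl. rewrite Rmult_1_r, <- Rmult_assoc.
  apply Rmult_le_compat_r; [apply Cmod_ge_0|].
  apply Rle_trans with ((B + 1) * (e / (B + 1))).
  - apply Rmult_le_compat; try apply Cmod_ge_0; lra.
  - right. field. lra.
Qed.

Lemma power_series_holo (c : nat -> C) (f : C -> C) : power_series c f -> holo_disk f.
Proof.
  intros H z Hz. destruct (ex_series_coef_deriv c f z H Hz) as [l Hl].
  exists l. now apply (power_series_is_derive c).
Qed.

Lemma power_series_Cder (c : nat -> C) (f : C -> C) :
  power_series c f -> power_series (coef_deriv c) (Cder f).
Proof.
  intros H z Hz. destruct (ex_series_coef_deriv c f z H Hz) as [l Hl].
  assert (D : @is_derive C_AbsRing C_NormedModule f z l) by now apply (power_series_is_derive c).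
  replace (Cder f z) with l; auto.
  (* [epsilon] returns some derivative at z; uniqueness of the derivative identifies it with the sum
     l. *)
  assert (D' : @is_derive C_AbsRing C_NormedModule f z (Cder f z)).
  { unfold Cder. apply epsilon_spec. now exists l. }
  rewrite <- (is_C_derive_unique f z l D). now apply is_C_derive_unique.
Qed.

Lemma power_series_ext (c d : nat -> C) (f : C -> C) :
  (forall k, c k = d k) -> power_series c f -> power_series d f.
Proof.
  intros E H z Hz. apply (is_series_ext (fun k => c k * z ^ k)%C); auto.
  intros k. now rewrite E.
Qed.

Lemma power_series_Cder_n (c : nat -> C) (f : C -> C) (n : nat) :
  power_series c f ->
  power_series (fun k => RtoC (INR (fact (k + n)) / INR (fact k)) * c (k + n)%nat)%C (Cder_n n f).
Proof.
  intros H. induction n as [|n IH].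
  - apply (power_series_ext c); auto. intros k. rewrite Nat.add_0_r.
    replace (INR (fact k) / INR (fact k)) with 1 by (field; apply INR_fact_neq_0). ring.
  - apply power_series_Cder in IH. revert IH. apply power_series_ext. intros k.
    unfold coef_deriv. rewrite <- Nat.add_succ_comm. rewrite Cmult_assoc, <- RtoC_mult.
    do 2 f_equal. rewrite (fact_simpl k), mult_INR. field.
    split; [apply INR_fact_neq_0 | apply not_0_INR; lia].
Qed.

Lemma power_series_dilate (c : nat -> C) (f : C -> C) (b : C) :
  Cmod b < 1 -> power_series c f ->
  power_series (fun k => b ^ k * c k)%C (fun z => f (b * z)%C).
Proof.
  intros Hb H z Hz.
  apply (is_series_ext (fun k => c k * (b * z) ^ k)%C).
  - intros k. rewrite Cpow_mult_l. simpl. ring.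
  - apply H. rewrite Cmod_mult. generalize (Cmod_ge_0 b) (Cmod_ge_0 z); nra.
Qed.

(** * Parseval's identity and the Hardy norm *)

Lemma Csum_ext_loc (a b : nat -> C) (n : nat) :
  (forall k, (k <= n)%nat -> a k = b k) -> Csum a n = Csum b n.
Proof. exact (@sum_n_ext_loc C_AbelianMonoid a b n). Qed.

Lemma Csum_zero (n : nat) : Csum (fun _ => 0%C) n = 0%C.
Proof.
  induction n as [|n IH]; [now rewrite Csum_0|]. rewrite Csum_S, IH. ring.
Qed.

Lemma Cconj_pow_circle (w : C) (m : nat) : w <> 0%C ->
  Cconj (w ^ m) = (RtoC (Cmod w ^ 2) ^ m * (/ w) ^ m)%C.
Proof.
  intros Hw. rewrite Cpow_conj, <- Cpow_mult_l. f_equal.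
  rewrite Cmod2_conj. field. auto.
Qed.

Lemma Cpow_mult_inv_pow (w : C) (k m : nat) : w <> 0%C -> (k <= m)%nat ->
  (w ^ k * (/ w) ^ m)%C = ((/ w) ^ (m - k))%C.
Proof.
  intros Hw Hk. replace m with (k + (m - k))%nat at 1 by lia.
  rewrite Cpow_add_r, Cmult_assoc, <- Cpow_mult_l, Cinv_r by auto.
  rewrite Cpow_1_l. ring.
Qed.

Lemma ex_RInt_Cmod2_circle (q : C -> C) (r : R) :
  (forall z, Cmod z = Rabs r -> Cdiff q z) ->
  ex_RInt (fun t => Cmod (q (polar r t)) ^ 2) 0 (2 * PI).
Proof.
  intros H.
  assert (E : forall u : C, fst u * fst u + snd u * snd u = Cmod u ^ 2).
  { intros u. rewrite Cmod2_alt. unfold Re, Im. ring. }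
  apply (ex_RInt_ext (fun t => fst (q (polar r t)) * fst (q (polar r t))
                              + snd (q (polar r t)) * snd (q (polar r t)))).
  { intros t _. apply E. }
  apply (ex_RInt_continuous (fun t => fst (q (polar r t)) * fst (q (polar r t))
                              + snd (q (polar r t)) * snd (q (polar r t)))).
  intros t _.
  destruct (polar_continuity q r t) as [C1 C2].
  { apply Cdiff_Ccont, H, Cmod_polar. }
  apply (continuous_plus (fun t => fst (q (polar r t)) * fst (q (polar r t)))
           (fun t => snd (q (polar r t)) * snd (q (polar r t)))).
  - apply (continuous_mult (fun t => fst (q (polar r t))) (fun t => fst (q (polar r t))));
      apply (continuous_slices (fun r t => fst (q (polar r t))) r t C1).
  - apply (continuous_mult (fun t => snd (q (polar r t))) (fun t => snd (q (polar r t))));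
      apply (continuous_slices (fun r t => snd (q (polar r t))) r t C2).
Qed.

Lemma Cdiff_Csum_pow (c : nat -> C) (n : nat) (z : C) :
  Cdiff (fun w => Csum (fun k => c k * w ^ k)%C n) z.
Proof.
  apply Cdiff_Csum. intros k. apply Cdiff_mult; [apply Cdiff_const|]. apply Cdiff_pow, Cdiff_id.
Qed.

(* On |w| = r one has Cconj w = r^2 / w, so the cross terms are means of w^-(m-k). *)
Lemma circle_mean_cross (c : nat -> C) (a : C) (n m : nat) (r : R) : 0 < r -> (n < m)%nat ->
  RInt (fun t => fst (Csum (fun k => c k * polar r t ^ k) n * Cconj (a * polar r t ^ m))%C)
    0 (2 * PI) = 0 /\
  ex_RInt (fun t => fst (Csum (fun k => c k * polar r t ^ k) n * Cconj (a * polar r t ^ m))%C)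
    0 (2 * PI).
Proof.
  intros Hr Hn. pose proof PI_RGT_0 as Hpi.
  set (X := fun w => Csum (fun k => (Cconj a * RtoC (r ^ 2) ^ m * c k) * (w ^ k * (/ w) ^ m))%C n).
  assert (Nz : forall w, Cmod w = Rabs r -> w <> 0%C).
  { intros w Hw. apply Cmod_gt_0. rewrite Hw. apply Rabs_pos_lt. lra. }
  assert (E : forall t, (Csum (fun k => c k * polar r t ^ k) n * Cconj (a * polar r t ^ m))%C
                        = X (polar r t)).
  { intros t. unfold X. rewrite Cmult_comm, Csum_scal. apply Csum_ext. intros k.
    rewrite Cmult_conj, Cconj_pow_circle by apply Nz, Cmod_polar.
    rewrite Cmod_polar, pow2_abs. ring. }
  assert (Dk : forall k w, Cmod w = Rabs r -> Cdiff (fun w => w ^ k * (/ w) ^ m)%C w).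
  { intros k w Hw. apply Cdiff_mult; [apply Cdiff_pow, Cdiff_id | now apply Cdiff_pow, Cdiff_Cinv, Nz]. }
  assert (Ds : forall k w, Cmod w = Rabs r ->
             Cdiff (fun w => Cconj a * RtoC (r ^ 2) ^ m * c k * (w ^ k * (/ w) ^ m))%C w).
  { intros k w Hw. apply Cdiff_mult; auto. apply Cdiff_const. }
  assert (Z : circle_mean X r = 0%C).
  { unfold X. rewrite circle_mean_Csum by auto.
    rewrite <- (Csum_zero n). apply Csum_ext_loc. intros k Hk.
    rewrite circle_mean_scal by (apply Cdiff_circle_integrable; auto).
    rewrite (circle_mean_ext _ (fun w => (/ w) ^ (m - k))%C).
    - rewrite circle_mean_pow_inv by (auto; lia). ring.
    - intros w Hw. apply Cpow_mult_inv_pow; [now apply Nz | lia]. }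
  split.
  - rewrite (RInt_ext _ (fun t => fst (X (polar r t)))) by (intros; now rewrite E).
    apply (f_equal fst) in Z. unfold circle_mean in Z.
    change (/ (2 * PI) * RInt (fun t => fst (X (polar r t))) 0 (2 * PI) = 0) in Z.
    apply (Rmult_eq_reg_l (/ (2 * PI))).
    + rewrite Z. ring.
    + apply Rinv_neq_0_compat. lra.
  - apply (ex_RInt_ext (fun t => fst (X (polar r t)))); [intros; now rewrite E|].
    apply (proj1 (A := ex_RInt (fun t => fst (X (polar r t))) 0 (2 * PI)) (B := ex_RInt (fun t => snd (X (polar r t))) 0 (2 * PI))).
    apply (Cdiff_circle_integrable X r). intros w Hw. apply Cdiff_Csum. auto.
Qed.

Lemma hardy_mean_polar (f : C -> C) (r : R) :
  hardy_mean f r = / (2 * PI) * RInt (fun t => Cmod (f (polar r t)) ^ 2) 0 (2 * PI).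
Proof. reflexivity. Qed.

Lemma hardy_mean_Csum (c : nat -> C) (r : R) (n : nat) : 0 < r ->
  hardy_mean (fun w => Csum (fun k => c k * w ^ k)%C n) r
  = sum_n (fun k => Cmod (c k) ^ 2 * (r ^ 2) ^ k) n.
Proof.
  intros Hr. pose proof PI_RGT_0 as Hpi.
  assert (Const : forall x : R, RInt (fun _ => x) 0 (2 * PI) = 2 * PI * x).
  { intros x. rewrite RInt_const. unfold scal; simpl; unfold mult; simpl. ring. }
  assert (Mono : forall k t, Cmod (c k * polar r t ^ k) ^ 2 = Cmod (c k) ^ 2 * (r ^ 2) ^ k).
  { intros k t. rewrite Cmod_mult, Cmod_pow, Cmod_polar, Rabs_pos_eq by lra.
    rewrite Rpow_mult_distr, <- !pow_mult. now rewrite Nat.mul_comm. }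
  induction n as [|n IH]; rewrite hardy_mean_polar in *.
  - rewrite sum_O, (RInt_ext _ (fun _ => Cmod (c O) ^ 2 * (r ^ 2) ^ 0)).
    + rewrite Const. field. lra.
    + intros t _. now rewrite Csum_0, Mono.
  - rewrite sum_n_S, <- IH.
    destruct (circle_mean_cross c (c (S n)) n (S n) r Hr (Nat.lt_succ_diag_r n)) as [X1 X2].
    set (X := fun t => fst (Csum (fun k => c k * polar r t ^ k)%C n
                            * Cconj (c (S n) * polar r t ^ S n))%C) in *.
    set (T := Cmod (c (S n)) ^ 2 * (r ^ 2) ^ S n).
    (* Expansion of |A + B|^2, where X is the real part of A times the conjugate of B, and |B|^2 is
       the constant T on the circle. *)
    rewrite (RInt_ext _ (fun t => Cmod (Csum (fun k => c k * polar r t ^ k)%C n) ^ 2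
                                  + (X t + X t + T))).
    2: { intros t _. rewrite Csum_S. unfold T. rewrite <- (Mono (S n) t). unfold X.
         set (A := Csum _ n). set (B := (c (S n) * polar r t ^ S n)%C).
         rewrite !Cmod2_alt. destruct A as [a1 a2], B as [b1 b2]. simpl. ring. }
    assert (I1 : ex_RInt (fun t => Cmod (Csum (fun k => c k * polar r t ^ k)%C n) ^ 2) 0 (2 * PI)).
    { apply (ex_RInt_Cmod2_circle (fun w => Csum (fun k => c k * w ^ k)%C n)).
      intros; apply Cdiff_Csum_pow. }
    assert (I2 : ex_RInt (fun t => X t + X t) 0 (2 * PI)) by exact (ex_RInt_plus X X _ _ X2 X2).
    assert (I3 : ex_RInt (fun _ => T) 0 (2 * PI)) by apply ex_RInt_const.
    assert (I4 : ex_RInt (fun t => X t + X t + T) 0 (2 * PI))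
      by exact (ex_RInt_plus (fun t => X t + X t) (fun _ => T) _ _ I2 I3).
    rewrite RInt_Rplus, (RInt_Rplus (fun t => X t + X t)), RInt_Rplus, X1, Const by assumption.
    field. lra.
Qed.

Lemma power_series_uniform (c : nat -> C) (f : C -> C) (r : R) :
  power_series c f -> 0 < r < 1 ->
  exists M q, 0 <= M /\ 0 < q < 1 /\ forall n z, Cmod z <= r ->
    Cmod (f z - Csum (fun k => c k * z ^ k)%C n) <= M * q ^ n.
Proof.
  intros H Hr. set (s := (1 + r) / 2).
  assert (Hs : 0 < s < 1) by (unfold s; lra). assert (Hrs : r < s) by (unfold s; lra).
  destruct (power_series_coef_bound c f s H Hs) as [M [HM HB]].
  set (q := r / s).
  assert (Hq : 0 < q < 1).
  { unfold q. split; [apply Rdiv_lt_0_compat; lra|].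
    apply (Rmult_lt_reg_r s); [lra|]. field_simplify; lra. }
  assert (Term : forall k z, Cmod z <= r -> Cmod (c k * z ^ k) <= M * q ^ k).
  { intros k z Hz. rewrite Cmod_mult, Cmod_pow.
    apply Rle_trans with (Cmod (c k) * (s ^ k * q ^ k)).
    - apply Rmult_le_compat_l; [apply Cmod_ge_0|]. rewrite <- Rpow_mult_distr.
      apply pow_incr. split; [apply Cmod_ge_0|]. unfold q. field_simplify; lra.
    - rewrite <- Rmult_assoc. apply Rmult_le_compat_r; [apply pow_le; lra | apply HB]. }
  assert (HM' : 0 <= M / (1 - q)).
  { apply Rmult_le_pos; [auto | apply Rlt_le, Rinv_0_lt_compat; lra]. }
  exists (M / (1 - q)), q. split; [|split]; auto. intros n z Hz.
  set (P := Csum (fun k => c k * z ^ k)%C).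
  (* Keeping the subtracted q^(n+d) makes the bound telescope, so the induction on d closes. *)
  assert (Diff : forall d, Cmod (P (n + d)%nat - P n) <= M / (1 - q) * (q ^ n - q ^ (n + d))).
  { induction d as [|d IH].
    - rewrite Nat.add_0_r. replace (P n - P n)%C with (RtoC 0) by ring. rewrite Cmod_0. lra.
    - rewrite Nat.add_succ_r. unfold P at 1. rewrite Csum_S. fold P.
      replace (P (n + d)%nat + c (S (n + d)) * z ^ S (n + d) - P n)%C
        with (P (n + d)%nat - P n + c (S (n + d)) * z ^ S (n + d))%C by ring.
      eapply Rle_trans; [apply Cmod_triangle|].
      specialize (Term (S (n + d)) z Hz).
      assert (M * q ^ S (n + d) <= M / (1 - q) * (q ^ (n + d) - q ^ S (n + d))).
      { replace (M / (1 - q) * (q ^ (n + d) - q ^ S (n + d))) with (M * q ^ (n + d))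
          by (simpl; field; lra).
        apply Rmult_le_compat_l; auto. simpl.
        assert (0 <= q ^ (n + d)) by (apply pow_le; lra). nra. }
      lra. }
  apply Cmod_lim_le. intros e He.
  destruct (proj1 (is_series_Cmod _ _) (H z ltac:(lra)) e He) as [N HN].
  exists (P (n + N)%nat - P n)%C. split.
  - replace (f z - P n - (P (n + N)%nat - P n))%C with (- (P (n + N)%nat - f z))%C by ring.
    rewrite Cmod_opp. apply Rlt_le, HN. lia.
  - eapply Rle_trans; [apply Diff|]. apply Rmult_le_compat_l; auto.
    assert (0 <= q ^ (n + N)) by (apply pow_le; lra). lra.
Qed.

Lemma parseval (c : nat -> C) (f : C -> C) (r : R) : power_series c f -> 0 < r < 1 ->
  is_series (fun k => Cmod (c k) ^ 2 * (r ^ 2) ^ k) (hardy_mean f r).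
Proof.
  intros H Hr. pose proof PI_RGT_0 as Hpi.
  destruct (power_series_uniform c f r H Hr) as (M & q & HM & Hq & HU).
  set (P := fun n w => Csum (fun k => c k * w ^ k)%C n).
  (* B bounds f and all partial sums on the circle: f is within M of c_0, and each partial sum is
     within M of f. The difference of squares is then at most 2 B times the uniform error. *)
  set (B := Cmod (c O) + 2 * M).
  assert (HB : 0 <= B) by (unfold B; generalize (Cmod_ge_0 (c O)); lra).
  assert (Hqn : forall n, 0 <= q ^ n <= 1).
  { intros n. split; [apply pow_le; lra|]. rewrite <- (pow1 n). apply pow_incr; lra. }
  assert (Bf : forall z, Cmod z <= r -> Cmod (f z) <= Cmod (c O) + M).
  { intros z Hz. specialize (HU O z Hz). rewrite Csum_0 in HU. simpl in HU.
    generalize (Cmod_Cmod_triangle (c O * 1)%C (f z)). rewrite Cmult_1_r in *. lra. }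
  assert (Close : forall n, Rabs (hardy_mean (P n) r - hardy_mean f r) <= 2 * B * M * q ^ n).
  { intros n. rewrite !hardy_mean_polar, <- Rmult_minus_distr_l.
    assert (I1 : ex_RInt (fun t => Cmod (P n (polar r t)) ^ 2) 0 (2 * PI)).
    { apply ex_RInt_Cmod2_circle. intros; apply Cdiff_Csum_pow. }
    assert (I2 : ex_RInt (fun t => Cmod (f (polar r t)) ^ 2) 0 (2 * PI)).
    { apply ex_RInt_Cmod2_circle. intros z Hz. apply (power_series_holo c f H).
      rewrite Hz, Rabs_pos_eq; lra. }
    replace (RInt (fun t => Cmod (P n (polar r t)) ^ 2) 0 (2 * PI)
             - RInt (fun t => Cmod (f (polar r t)) ^ 2) 0 (2 * PI))
      with (RInt (fun t => Cmod (P n (polar r t)) ^ 2 - Cmod (f (polar r t)) ^ 2) 0 (2 * PI)).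
    2: { exact (RInt_minus (V := R_CompleteNormedModule) _ _ _ _ I1 I2). }
    rewrite Rabs_mult, Rabs_pos_eq by (apply Rlt_le, Rinv_0_lt_compat; lra).
    replace (2 * B * M * q ^ n) with (/ (2 * PI) * ((2 * PI - 0) * (2 * B * M * q ^ n)))
      by (field; lra).
    apply Rmult_le_compat_l; [apply Rlt_le, Rinv_0_lt_compat; lra|].
    apply abs_RInt_le_const; [lra | |].
    - exact (ex_RInt_minus _ _ _ _ I1 I2).
    - intros t _.
      assert (Hz : Cmod (polar r t) <= r) by (rewrite Cmod_polar, Rabs_pos_eq; lra).
      specialize (HU n _ Hz). fold (P n (polar r t)) in HU. specialize (Bf _ Hz).
      set (u := f (polar r t)) in *. set (v := P n (polar r t)) in *.
      pose proof (Cmod_Cmod_triangle u v) as T1. pose proof (Cmod_Cmod_triangle v u) as T2.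
      rewrite (Cmod_minus_sym v u) in T1.
      assert (Hd : M * q ^ n <= M) by (generalize (Hqn n); nra).
      pose proof (Cmod_ge_0 u). pose proof (Cmod_ge_0 v).
      replace (Cmod v ^ 2 - Cmod u ^ 2) with ((Cmod v - Cmod u) * (Cmod v + Cmod u)) by ring.
      rewrite Rabs_mult, (Rabs_pos_eq (Cmod v + Cmod u)) by lra.
      replace (2 * B * M * q ^ n) with (M * q ^ n * (2 * B)) by ring.
      apply Rmult_le_compat; [apply Rabs_pos | lra | apply Rabs_le; lra | unfold B; lra]. }
  assert (L : is_lim_seq (fun n => hardy_mean (P n) r) (hardy_mean f r)).
  { apply (is_lim_seq_ext (fun n => (hardy_mean (P n) r - hardy_mean f r) + hardy_mean f r)).
    { intros; ring. }
    replace (Finite (hardy_mean f r)) with (Finite (0 + hardy_mean f r)) by (f_equal; ring).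
    apply is_lim_seq_plus'; [|apply is_lim_seq_const].
    apply is_lim_seq_abs_0.
    apply (is_lim_seq_le_le (fun _ => 0) _ (fun n => 2 * B * M * q ^ n)).
    - intros n. split; [apply Rabs_pos | apply Close].
    - apply is_lim_seq_const.
    - replace (Finite 0) with (Rbar_mult (2 * B * M) 0) by (simpl; f_equal; ring).
      apply is_lim_seq_scal_l, is_lim_seq_geom. rewrite Rabs_pos_eq; lra. }
  exact (is_lim_seq_ext _ _ _ (fun n => hardy_mean_Csum c r n (proj1 Hr)) L).
Qed.

(** * The supremum of the means and the coefficient sums *)

(** [real] sends both infinities to 0. The member x excludes minus infinity and the bound M excludes
    plus infinity, so nothing is lost. *)
Lemma Lub_Rbar_bounded (E : R -> Prop) (x M : R) :
  E x -> (forall y, E y -> y <= M) ->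
  real (Lub_Rbar E) <= M /\ forall y, E y -> y <= real (Lub_Rbar E).
Proof.
  intros Hx HM. destruct (Lub_Rbar_correct E) as [U L].
  assert (LM : Rbar_le (Lub_Rbar E) M) by (apply L; intros y Hy; now apply HM).
  pose proof (U x Hx) as Ux.
  destruct (Lub_Rbar E) as [s| |]; simpl in *; tauto.
Qed.

(** The limit r -> 1 in a finite sum, made explicit: with r = 1 - h every weight is at least r^(2n),
    and Bernoulli's inequality gives r^(2n) >= 1 - 2 n h. *)
Lemma sum_n_Abel_le (a : nat -> R) (L : R) (n : nat) :
  (forall k, 0 <= a k) ->
  (forall r, 0 < r < 1 -> sum_n (fun k => a k * (r ^ 2) ^ k) n <= L) -> sum_n a n <= L.
Proof.
  intros Ha H.
  assert (S0 : forall m, 0 <= sum_n a m).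
  { induction m as [|m IH]; [rewrite sum_O; auto|]. rewrite sum_n_S. specialize (Ha (S m)). lra. }
  assert (Low : forall x m, 0 < x < 1 -> x ^ m * sum_n a m <= sum_n (fun k => a k * x ^ k) m).
  { intros x m Hx. induction m as [|m IH]; [rewrite !sum_O; simpl; lra|].
    rewrite !sum_n_S. assert (0 <= x ^ m * sum_n a m).
    { apply Rmult_le_pos; auto. apply pow_le; lra. }
    simpl (x ^ S m). nra. }
  assert (Bern : forall h m, 0 < h < 1 -> 1 - INR m * h <= (1 - h) ^ m).
  { intros h m Hh. induction m as [|m IH]; [simpl; lra|].
    rewrite S_INR. simpl. generalize (pos_INR m). nra. }
  apply le_epsilon. intros e He.
  set (S := sum_n a n). set (K := INR (2 * n) * S).
  assert (HK : 0 <= K) by (apply Rmult_le_pos; [apply pos_INR | apply S0]).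
  (* K h is the mass lost to the weights, so this h makes the loss at most e; the bound 1/2 keeps r
     inside (0, 1). *)
  set (h := Rmin (/ 2) (e / (K + 1))).
  assert (Hh : 0 < h < 1).
  { unfold h. split; [apply Rmin_pos; [lra | apply Rdiv_lt_0_compat; lra]|].
    eapply Rle_lt_trans; [apply Rmin_l | lra]. }
  specialize (H (1 - h) ltac:(lra)).
  specialize (Low ((1 - h) ^ 2) n ltac:(split; [apply pow_lt; lra | nra])).
  rewrite <- pow_mult in Low. fold S in Low.
  specialize (Bern h (2 * n)%nat Hh).
  assert (HKe : K * h <= e).
  { apply Rle_trans with ((K + 1) * (e / (K + 1))).
    - apply Rmult_le_compat; try lra. apply Rmin_r.
    - right; field; lra. }
  assert ((1 - INR (2 * n) * h) * S <= (1 - h) ^ (2 * n) * S).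
  { apply Rmult_le_compat_r; [apply S0 | exact Bern]. }
  unfold K in HKe. lra.
Qed.

Lemma H2norm_sq_bounds (c : nat -> C) (f : C -> C) (M : R) :
  power_series c f -> (forall r, 0 < r < 1 -> hardy_mean f r <= M) ->
  H2norm f ^ 2 <= M /\ forall r, 0 < r < 1 -> hardy_mean f r <= H2norm f ^ 2.
Proof.
  intros H HM. unfold H2norm.
  assert (Hhalf : 0 < / 2 < 1) by lra.
  destruct (Lub_Rbar_bounded (hardy_means f) (hardy_mean f (/ 2)) M) as [U L].
  - now exists (/ 2).
  - intros y [r [Hr ->]]. now apply HM.
  - assert (L' : forall r, 0 < r < 1 -> hardy_mean f r <= real (Lub_Rbar (hardy_means f))).
    { intros r Hr. apply L. now exists r. }
    (* The supremum must be nonnegative for squaring to undo [sqrt]. *)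
    assert (P : 0 <= hardy_mean f (/ 2)).
    { assert (Pos : forall k, 0 <= Cmod (c k) ^ 2 * ((/ 2) ^ 2) ^ k).
      { intros k. apply Rmult_le_pos; apply pow_le; [apply Cmod_ge_0 | apply pow_le; lra]. }
      eapply Rle_trans; [|apply (sum_n_le_lim _ _ O Pos (parseval c f (/ 2) H Hhalf))].
      rewrite sum_O. apply Pos. }
    rewrite pow2_sqrt; auto. eapply Rle_trans; [exact P | now apply L'].
Qed.

(** One half of the identity between |f|^2 and the sum of |c_k|^2; [in_H2_of_coef_sum] is the other.
    Both speak of partial sums only. *)
Lemma coef_sum_le_H2norm (c : nat -> C) (f : C -> C) (n : nat) :
  power_series c f -> in_H2 f -> sum_n (fun k => Cmod (c k) ^ 2) n <= H2norm f ^ 2.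
Proof.
  intros H [_ [M HM]].
  destruct (H2norm_sq_bounds c f M H) as [_ L].
  { intros r Hr. apply HM. now exists r. }
  apply sum_n_Abel_le; [intros; apply pow_le, Cmod_ge_0|].
  intros r Hr. eapply Rle_trans; [|apply (L r Hr)].
  apply sum_n_le_lim; [|now apply parseval].
  intros k. apply Rmult_le_pos; apply pow_le; [apply Cmod_ge_0 | apply pow_le; lra].
Qed.

Lemma in_H2_of_coef_sum (c : nat -> C) (f : C -> C) (M : R) :
  power_series c f -> (forall n, sum_n (fun k => Cmod (c k) ^ 2) n <= M) ->
  in_H2 f /\ H2norm f ^ 2 <= M.
Proof.
  intros H HM.
  assert (B : forall r, 0 < r < 1 -> hardy_mean f r <= M).
  { intros r Hr.
    apply (is_lim_seq_le (sum_n (fun k => Cmod (c k) ^ 2 * (r ^ 2) ^ k)) (fun _ => M)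
             (hardy_mean f r) M).
    - intros n. eapply Rle_trans; [apply sum_n_le_compat | apply (HM n)].
      intros k. apply Rle_trans with (Cmod (c k) ^ 2 * 1); [|lra].
      apply Rmult_le_compat_l; [apply pow_le, Cmod_ge_0|].
      rewrite <- (pow1 k). apply pow_incr. split; [apply pow_le; lra | nra].
    - exact (parseval c f r H Hr).
    - apply is_lim_seq_const. }
  split; [split|].
  - now apply (power_series_holo c).
  - exists M. intros x [r [Hr ->]]. auto.
  - now apply (H2norm_sq_bounds c).
Qed.

(** * The norm of the composition-differentiation operator *)

(** [up x] is the integer in (x, x + 1], so [up x - 1] is the floor even when x is an integer. *)
Lemma floor_nat_bounds (x : R) : 0 <= x ->
  INR (floor_nat x) <= x < INR (floor_nat x) + 1.
Proof.
  intros Hx. unfold floor_nat. destruct (archimed x) as [A1 A2].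
  assert (Hz : (0 <= up x - 1)%Z).
  { assert (0 < up x)%Z by (apply lt_IZR; lra). lia. }
  rewrite INR_IZR_INZ, Z2Nat.id, minus_IZR by exact Hz. lra.
Qed.

Lemma unimodal_max (v : nat -> R) (m : nat) :
  (forall j, (j < m)%nat -> v j <= v (S j)) ->
  (forall j, (m <= j)%nat -> v (S j) <= v j) -> forall j, v j <= v m.
Proof.
  intros Up Down j. destruct (Nat.le_ge_cases j m) as [H|H].
  - remember (m - j)%nat as d eqn:E. revert j H E.
    induction d as [|d IH]; intros j H E.
    + replace j with m by lia. lra.
    + eapply Rle_trans; [apply Up; lia | apply IH; lia].
  - induction H as [|j H IH]; [lra|]. eapply Rle_trans; [apply Down; lia | exact IH].
Qed.

Definition monomial_gain (n : nat) (beta : R) (j : nat) : R :=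
  INR (fact (j + n)) / INR (fact j) * beta ^ j.

Lemma monomial_gain_pos (n : nat) (beta : R) (j : nat) : 0 < beta -> 0 < monomial_gain n beta j.
Proof.
  intros H. apply Rmult_lt_0_compat; [|now apply pow_lt].
  apply Rdiv_lt_0_compat; apply INR_fact_lt_0.
Qed.

(** The gain at j + 1 is (j + 1 + n) beta / (j + 1) times the gain at j, and this ratio is at least
    1 exactly when j + 1 + n <= n / (1 - beta). So the gains rise up to m and fall afterwards. *)
Lemma monomial_gain_max (n m : nat) (beta : R) : 0 < beta < 1 ->
  INR (m + n) <= INR n / (1 - beta) < INR (m + n) + 1 ->
  forall j, monomial_gain n beta j <= monomial_gain n beta m.
Proof.
  intros Hb [B1 B2].
  apply (Rmult_le_compat_r (1 - beta)) in B1; [|lra].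
  apply (Rmult_lt_compat_r (1 - beta)) in B2; [|lra].
  replace (INR n / (1 - beta) * (1 - beta)) with (INR n) in B1, B2 by (field; lra).
  rewrite plus_INR in B1, B2.
  assert (Step : forall j, monomial_gain n beta (S j) * INR (S j)
                           = monomial_gain n beta j * (INR (S j + n) * beta)).
  { intros j. unfold monomial_gain. rewrite Nat.add_succ_l, (fact_simpl (j + n)), (fact_simpl j).
    rewrite !mult_INR. simpl (beta ^ S j). field.
    split; [apply INR_fact_neq_0 | apply not_0_INR; lia]. }
  assert (P : forall j, 0 < monomial_gain n beta j) by (intros; apply monomial_gain_pos; lra).
  apply unimodal_max; intros j Hj; apply (Rmult_le_reg_r (INR (S j)));
    try (apply lt_0_INR; lia); rewrite Step; specialize (P j).
  - apply Rmult_le_compat_l; [lra|]. rewrite plus_INR.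
    apply le_INR in Hj. nra.
  - apply Rmult_le_compat_l; [lra|]. rewrite plus_INR.
    apply le_INR in Hj. rewrite S_INR in *. nra.
Qed.

Lemma sum_n_shift_le (a : nat -> R) (n m : nat) : (forall k, 0 <= a k) ->
  sum_n (fun k => a (k + n)%nat) m <= sum_n a (m + n).
Proof.
  intros Ha.
  assert (Last : forall k, a k <= sum_n a k).
  { intros k. assert (S0 : forall i, 0 <= sum_n a i).
    { induction i as [|i IH]; [rewrite sum_O; auto|]. rewrite sum_n_S. specialize (Ha (S i)). lra. }
    destruct k as [|k]; [rewrite sum_O; lra|]. rewrite sum_n_S. specialize (S0 k). lra. }
  induction m as [|m IH].
  - rewrite sum_O. apply Last.
  - rewrite sum_n_S, Nat.add_succ_l, sum_n_S. lra.
Qed.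

Lemma sum_n_ge_term (a : nat -> R) (m : nat) : (forall k, 0 <= a k) -> a m <= sum_n a m.
Proof.
  intros Ha. assert (S := sum_n_shift_le a m 0 Ha). rewrite sum_O in S. exact S.
Qed.

Lemma monomial_power_series (m : nat) :
  power_series (fun k => if Nat.eqb k m then 1%C else 0%C) (fun z => z ^ m)%C.
Proof.
  intros z _. apply is_series_Cmod. intros e He. exists m. intros n Hn.
  rewrite (Csum_ext _ (fun k => if Nat.eqb k m then (z ^ m)%C else 0%C)).
  - rewrite Csum_delta. destruct (Nat.leb_spec m n); [|lia].
    replace (z ^ m - z ^ m)%C with (RtoC 0) by ring. now rewrite Cmod_0.
  - intros k. destruct (Nat.eqb_spec k m) as [->|]; ring.
Qed.

Lemma monomial_in_H2 (m : nat) :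
  in_H2 (fun z => z ^ m)%C /\ H2norm (fun z => z ^ m)%C ^ 2 <= 1.
Proof.
  apply (in_H2_of_coef_sum _ _ 1 (monomial_power_series m)). intros n.
  set (a := fun k => Cmod (if Nat.eqb k m then 1%C else 0%C) ^ 2).
  assert (Ea : forall k, a k = if Nat.eqb k m then 1 else 0).
  { intros k. unfold a. destruct (Nat.eqb k m); rewrite ?Cmod_1, ?Cmod_0; ring. }
  assert (E : sum_n a n = if Nat.leb m n then 1 else 0).
  { induction n as [|n IH].
    - rewrite sum_O, Ea. now destruct m.
    - rewrite sum_n_S, IH, Ea.
      destruct (Nat.eqb_spec (S n) m), (Nat.leb_spec m n), (Nat.leb_spec m (S n)); try lia; lra. }
  rewrite E. destruct (Nat.leb m n); lra.
Qed.

Definition comp_diff_coef (n : nat) (b : C) (c : nat -> C) (k : nat) : C :=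
  (b ^ k * (RtoC (INR (fact (k + n)) / INR (fact k)) * c (k + n)%nat))%C.

Lemma comp_diff_power_series (n : nat) (b : C) (c : nat -> C) (f : C -> C) :
  Cmod b < 1 -> power_series c f ->
  power_series (comp_diff_coef n b c) (comp_diff (fun z => Cmult b z) n f).
Proof.
  intros Hb H. apply (power_series_dilate _ (Cder_n n f) b Hb).
  now apply power_series_Cder_n.
Qed.

Lemma Cmod_comp_diff_coef (n : nat) (b : C) (c : nat -> C) (k : nat) :
  Cmod (comp_diff_coef n b c k) = monomial_gain n (Cmod b) k * Cmod (c (k + n)%nat).
Proof.
  unfold comp_diff_coef, monomial_gain. rewrite !Cmod_mult, Cmod_pow, Cmod_R, Rabs_pos_eq.
  - ring.
  - apply Rlt_le, Rdiv_lt_0_compat; apply INR_fact_lt_0.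
Qed.

Lemma H2norm_nonneg (f : C -> C) : 0 <= H2norm f.
Proof. apply sqrt_pos. Qed.

(** The operator is a weighted shift on coefficients: each weight is at most A, and dropping the
    first n coefficients of f can only decrease the sum of squares. *)
Lemma comp_diff_bound (n : nat) (b : C) (A : R) (f : C -> C) :
  Cmod b < 1 -> 0 <= A -> (forall j, 0 <= monomial_gain n (Cmod b) j <= A) -> in_H2 f ->
  in_H2 (comp_diff (fun z => Cmult b z) n f) /\
  H2norm (comp_diff (fun z => Cmult b z) n f) <= A * H2norm f.
Proof.
  intros Hb HA Hg Hf.
  pose proof (taylor_power_series f (proj1 Hf)) as Hc. set (c := taylor_coef f) in Hc.
  destruct (in_H2_of_coef_sum _ _ ((A * H2norm f) ^ 2) (comp_diff_power_series n b c f Hb Hc))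
    as [G1 G2].
  - intros m. apply Rle_trans with (A ^ 2 * sum_n (fun k => Cmod (c (k + n)%nat) ^ 2) m).
    + rewrite <- sum_n_scal_r. apply sum_n_le_compat. intros k.
      rewrite Cmod_comp_diff_coef, Rpow_mult_distr.
      apply Rmult_le_compat_r; [apply pow_le, Cmod_ge_0 | now apply pow_incr].
    + rewrite Rpow_mult_distr. apply Rmult_le_compat_l; [now apply pow_le|].
      eapply Rle_trans; [apply (sum_n_shift_le (fun k => Cmod (c k) ^ 2))|].
      * intros k. apply pow_le, Cmod_ge_0.
      * now apply coef_sum_le_H2norm.
  - split; auto.
    rewrite <- !Rsqr_pow2 in G2. apply (Rsqr_incr_0_var _ _ G2).
    apply Rmult_le_pos; [exact HA | apply H2norm_nonneg].
Qed.

(** The single coefficient of degree m of the image already has modulus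
    [monomial_gain n (Cmod b) m], and the norm dominates each coefficient. *)
Lemma comp_diff_monomial_ge (n m : nat) (b : C) :
  Cmod b < 1 -> in_H2 (comp_diff (fun z => Cmult b z) n (fun z => z ^ (m + n))%C) ->
  monomial_gain n (Cmod b) m <= H2norm (comp_diff (fun z => Cmult b z) n (fun z => z ^ (m + n))%C).
Proof.
  intros Hb H.
  pose proof (comp_diff_power_series n b _ _ Hb (monomial_power_series (m + n))) as Hd.
  pose proof (coef_sum_le_H2norm _ _ m Hd H) as G.
  pose proof (sum_n_ge_term (fun k => Cmod (comp_diff_coef n b
    (fun k => if Nat.eqb k (m + n) then 1%C else 0%C) k) ^ 2) m
    ltac:(intros; apply pow_le, Cmod_ge_0)) as T.
  cbv beta in T. rewrite Cmod_comp_diff_coef, Nat.eqb_refl, Cmod_1, Rmult_1_r in T.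
  apply (Rle_trans _ _ _ T) in G. rewrite <- !Rsqr_pow2 in G.
  apply (Rsqr_incr_0_var _ _ G), H2norm_nonneg.
Qed.

Theorem theorem3p3 (n : nat) (b : C) :
  (0 < n)%nat -> b <> (0%R, 0%R) -> Cmod b < 1 ->
  let phi := fun z : C => Cmult b z in
  let N := floor_nat (INR n / (1 - Cmod b)) in
  (forall f, in_H2 f -> in_H2 (comp_diff phi n f)) /\
  is_lub (fun y => exists f, in_H2 f /\ H2norm f <= 1 /\ y = H2norm (comp_diff phi n f))
         (INR (fact n) * Binomial.C N n * Cmod b ^ (N - n)).
Proof.
  intros _ Hb0 Hb phi N.
  assert (Hpos : 0 < Cmod b) by (now apply Cmod_gt_0).
  set (x := INR n / (1 - Cmod b)) in N.
  (* This gives n <= N, so that the natural subtraction N - n is a true one and m + n = N. *)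
  assert (Hx : INR n <= x).
  { apply (Rmult_le_reg_r (1 - Cmod b)); [lra|]. unfold x. field_simplify; [|lra].
    generalize (pos_INR n). nra. }
  destruct (floor_nat_bounds x) as [F1 F2]; [generalize (pos_INR n); lra|].
  fold N in F1, F2.
  assert (HnN : (n <= N)%nat).
  { apply Nat.lt_succ_r, INR_lt. rewrite S_INR. lra. }
  set (m := (N - n)%nat). assert (EN : N = (m + n)%nat) by (unfold m; lia).
  assert (Max := monomial_gain_max n m (Cmod b) (conj Hpos Hb) ltac:(rewrite <- EN; split; assumption)).
  assert (Pos := fun j => Rlt_le _ _ (monomial_gain_pos n (Cmod b) j Hpos)).
  (* The n! cancels against the binomial coefficient and leaves N! / (N - n)!. *)
  assert (EA : INR (fact n) * Binomial.C N n * Cmod b ^ m = monomial_gain n (Cmod b) m).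
  { unfold Binomial.C, monomial_gain. fold m. rewrite <- EN. field.
    split; apply INR_fact_neq_0. }
  rewrite EA. set (A := monomial_gain n (Cmod b) m) in *.
  assert (Bound := fun f => comp_diff_bound n b A f Hb (Pos m) (fun j => conj (Pos j) (Max j))).
  split; [intros f Hf; now apply Bound|]. split.
  - intros y (f & Hf & Hf1 & ->). eapply Rle_trans; [now apply Bound|].
    rewrite <- (Rmult_1_r A) at 2. apply Rmult_le_compat_l; [apply Pos | exact Hf1].
  - intros M HM.
    (* The monomial z^N lies in the unit ball and attains the supremum. *)
    destruct (monomial_in_H2 (m + n)) as [Hin Hnorm].
    eapply Rle_trans; [apply comp_diff_monomial_ge; [exact Hb | now apply Bound]|].
    apply HM. eexists; split; [exact Hin | split; [|reflexivity]].
    apply Rsqr_incr_0_var; [|lra]. now rewrite Rsqr_1, Rsqr_pow2.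
Qed.
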